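(* Let $G$ be a finite group with $\pi_e(G)\subseteq\{1,2,3,4,6\}$ that has precisely three cyclic subgroups of order $6$. Then there exist two cyclic subgroups of order $6$ in $G$ whose intersection has order $3$ if and only if $G$ is isomorphic to one of the groups with GAP SmallGroup identifiers $[12,5]\cong\mathbb{Z}_2\times\mathbb{Z}_6$, $[18,3]\cong\mathbb{Z}_3\times S_3$, $[24,7]\cong\mathbb{Z}_2\times(\mathbb{Z}_3\rtimes\mathbb{Z}_4)$, $[24,8]\cong(\mathbb{Z}_6\times\mathbb{Z}_2)\rtimes\mathbb{Z}_2$, $[24,14]\cong\mathbb{Z}_2\times\mathbb{Z}_2\times S_3$, $[36,11]\cong\mathbb{Z}_3\times A_4$, $[72,43]\cong(\mathbb{Z}_3\times A_4)\rtimes\mathbb{Z}_2$.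
   Context: $\pi_e(G)$ is the set of orders of elements of $G$. The GAP identifier $[n,m]$ denotes the $m$-th group of order $n$ in the GAP SmallGroups library, which determines the semidirect products listed. *)

(* Defs.v *)
From mathcomp Require Import all_boot all_fingroup all_algebra all_solvable.
Set Implicit Arguments. Unset Strict Implicit. Unset Printing Implicit Defensive.
Local Open Scope group_scope.

Definition cyc6_subgroups (gT : finGroupType) (G : {set gT}) : {set {group gT}} :=
  [set H : {group gT} | [&& H \subset G, cyclic H & #|H| == 6]].

Definition S3xS4 := ({perm 'I_3} * {perm 'I_4})%type.

Definition signmatch (K : {set {perm 'I_4}}) : {set S3xS4} :=
  [set p in setX [set: {perm 'I_3}] K | odd_perm p.1 == odd_perm p.2].

Definition cyc4 : {perm 'I_4} :=
  tperm (inord 0) (inord 1) * tperm (inord 1) (inord 2) * tperm (inord 2) (inord 3).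
Definition dtrans : {perm 'I_4} := tperm (inord 0) (inord 1) * tperm (inord 2) (inord 3).

Definition G12_5 : {set ('Z_2 * 'Z_6)%type} := [set: ('Z_2 * 'Z_6)%type].
Definition G18_3 : {set ('Z_3 * {perm 'I_3})%type} := [set: ('Z_3 * {perm 'I_3})%type].
(* [24,7] = Z_2 x (Z_3 : Z_4); Z_3 : Z_4 = {(a,b) in S_3 x <(0123)> | sgn a = sgn b} *)
Definition G24_7 : {set ('Z_2 * S3xS4)%type} := setX [set: 'Z_2] (signmatch <[cyc4]>).
(* [24,8] = (Z_6 x Z_2) : Z_2 = Z_3 : D_8 (kernel of the action a Klein four group),
   realised as {(a,b) in S_3 x C_{S_4}((01)(23)) | sgn a = sgn b} *)
Definition G24_8 : {set S3xS4} := signmatch 'C[dtrans].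
Definition G24_14 : {set ('Z_2 * 'Z_2 * {perm 'I_3})%type} :=
  [set: ('Z_2 * 'Z_2 * {perm 'I_3})%type].
Definition G36_11 : {set ('Z_3 * {perm 'I_4})%type} := setX [set: 'Z_3] ('Alt_('I_4)).
(* [72,43] = (Z_3 x A_4) : Z_2 = Z_3 : S_4,
   realised as {(a,b) in S_3 x S_4 | sgn a = sgn b} *)
Definition G72_43 : {set S3xS4} := signmatch [set: {perm 'I_4}].

(* Main.v *)
(** Let x generate the intersection of order 3 and put C = C_G(x). The cyclic
    subgroups of order 6 containing x correspond to the involutions of C, whose
    number is odd, so there are exactly three involutions in C and every cyclic
    subgroup of order 6 contains x. Hence <x> is normal, |G : C| <= 2, C has no
    element of order 4, and an element of order 3 commuting with an involution
    lies in <x>; this forces |C| = 12, 18 or 36. If a Sylow 2-subgroup of C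
    has order 2 then G = C = Z_3 x S_3. Otherwise the three involutions and 1
    form a normal Klein four-group V, and G is a semidirect product of <x> by a
    complement S acting through a sign, with S one of V, A_4 (G = C) or
    Z_4 x Z_2, D_8, Z_2^3, S_4 (|G : C| = 2). *)
Require Import Defs.
From mathcomp Require Import all_boot all_fingroup all_algebra all_solvable.
Set Implicit Arguments. Unset Strict Implicit. Unset Printing Implicit Defensive.
Local Open Scope group_scope.

(** The semidirect products are recognised without presentations. If [S] is a complement to [<[x]>],
    then [G] acts on the three cosets of [S] with kernel ['C_S(<[x]>)] and projects onto [S] with
    kernel [<[x]>]; the two maps together are injective. Once [S] is embedded in the symmetric group
    on four points so that its even elements are exactly those centralising [x], the image consists
    of pairs of equal sign, and comparing orders finishes. The obstacle is the embedding: subgroups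
    of order 8 of [S_4] are dihedral, so for [Z_4 x Z_2] and [Z_2^3] a direct factor inside [V] has
    to be split off first. For [D_8], [A_4] and [S_4] the embedding is the affine action on [V],
    faithful because no nontrivial element of the complement to [V] centralises [V]. *)

(* V acts on itself by translation and M by conjugation; this is the action of
   W on the right cosets of M. *)
Lemma affine_perm (gT : finGroupType) (V M W : {group gT}) (I : finType) (e : I -> gT) :
  V ><| M = W -> injective e -> e @: [set: I] = V ->
  exists f : {morphism W >-> {perm I}},
   [/\ 'ker f = 'C_M(V), {in V, forall v i, e (f v i) = e i * v}
     & {in M, forall m i, e (f m i) = e i ^ m}].
Proof.
move=> defW injE imE.
have [nVW sMW defVM nVM tiVM] := sdprod_context defW.
(* For [g = v * m] this is [(w * v) ^ m], the unique representative in [V] of the coset [M w g]. *)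
pose h g w := (remgr V M g)^-1 * w * g.
have remM : {in W, forall g, remgr V M g \in M}.
  by move=> g Wg; rewrite mem_remgr // defVM.
have hV g w : g \in W -> w \in V -> h g w \in V.
  move=> Wg Vw; rewrite /h {2}(divgr_eq V M g).
  rewrite -mulgA (mulgA w) -conjgE memJ_norm ?(subsetP nVM) ?remM //.
  by rewrite groupM // mem_divgr // defVM.
have remMM : {in W &, {morph remgr V M : x y / x * y}}.
  by apply: remgrM => //; apply/complP; split.
have exP g : g \in W -> [pick p : {perm I} | [forall i, e (p i) == h g (e i)]] != None.
  move=> Wg; case: pickP => // noP.
  have eV i : e i \in V by rewrite -imE imset_f // inE.
  have exj i : exists j, e j == h g (e i).
    by have := hV g _ Wg (eV i); rewrite -imE => /imsetP[j _ ->]; exists j.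
  pose F i := xchoose (exj i).
  have eF i : e (F i) = h g (e i) by apply/eqP/(xchooseP (exj i)).
  have injF : injective F.
    move=> i j Fij; apply: injE; have:= eF i; rewrite Fij eF /h => /mulIg/mulgI ->//.
  by have /forallP[] := noP (perm injF); move=> i; rewrite permE eF.
(* The default 1 is never reached on [W], by [exP]; outside [W] the value is irrelevant to a
   morphism with domain [W]. *)
pose f g := odflt 1 [pick p : {perm I} | [forall i, e (p i) == h g (e i)]].
have eV i : e i \in V by rewrite -imE imset_f // inE.
have fE g : g \in W -> forall i, e (f g i) = h g (e i).
  move=> /exP; rewrite /f; case: pickP => //= p /forallP hp _ i; exact/eqP.
have fM : {in W &, {morph f : x y / x * y}}.
  move=> g1 g2 W1 W2; apply/permP=> i; apply: injE; rewrite permM !fE ?groupM //.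
  by rewrite /h remMM // invMg !mulgA.
exists (Morphism fM); split.
- apply/setP=> g; apply/idP/idP => [kg | /setIP[Mg /centP cg]].
    have Wg := dom_ker kg.
    have hw w : w \in V -> h g w = w.
      rewrite -imE => /imsetP[i _ ->]; rewrite -fE // -[f g]/(Morphism fM g) (mker kg).
      by rewrite perm1.
    have Mg : g \in M.
      have := hw _ (group1 V); rewrite /h mulg1 => /(canRL (mulKVg _)).
      by rewrite mulg1 => ->; rewrite remM.
    rewrite inE Mg; apply/centP=> w Vw; have := hw w Vw.
    by rewrite /h remgr_id // -mulgA /commute => /(canRL (mulKVg _)) ->.
  rewrite !inE (subsetP sMW) //; apply/eqP/permP=> i; apply: injE.
  rewrite perm1 fE ?(subsetP sMW) // /h remgr_id // -mulgA.
  by rewrite -(cg _ (eV i)) mulKg.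
- move=> v Vv i; rewrite fE; last by rewrite (subsetP (normal_sub nVW)).
  by rewrite /h -[v in remgr _ _ v]mulg1 remgrMid // invg1 mul1g.
- by move=> m Mm i; rewrite fE ?(subsetP sMW) // /h remgr_id // -mulgA -conjgE.
Qed.

(** * Signs of permutations and sign-matched pairs *)

Section Sign.
Variables (gT : finGroupType) (I : finType) (G : {group gT}).

(** Elements outside a subgroup of index 2 form one coset, so they share a sign once [C] maps to
    even permutations; that sign must be odd, or all of [G] would have even image. *)
Lemma odd_perm_index2 (C : {group gT}) (h : {morphism G >-> {perm I}}) :
  C \subset G -> #|G : C| = 2 -> h @* C \subset 'Alt_I -> ~~ (h @* G \subset 'Alt_I) ->
  {in G, forall g, odd_perm (h g) = (g \notin C)}.
Proof.
move=> sCG iC evC noG g Gg.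
have evenC c : c \in C -> odd_perm (h c) = false.
  move=> Cc; have /(subsetP evC) : h c \in h @* C by rewrite mem_morphim // (subsetP sCG).
  by rewrite Alt_even => /negbTE.
case Cg: (g \in C); first exact: evenC.
apply/idPn => /= evg; case/negP: noG; apply/subsetP=> _ /morphimP[k _ Gk ->].
rewrite Alt_even; case Ck: (k \in C); first by rewrite evenC.
have : k \in C :* g by rewrite (rcoset_index2 sCG iC) inE ?Cg ?Ck.
case/rcosetP=> c Cc ->; have Gc := subsetP sCG c Cc.
by rewrite morphM // odd_permM evenC // (negbTE evg).
Qed.

End Sign.

Lemma set_labelling (T : finType) (A : {set T}) n :
  #|A| = n -> exists2 e : 'I_n -> T, injective e & e @: [set: 'I_n] = A.
Proof.
move=> <-; exists enum_val; first exact: enum_val_inj.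
apply/setP=> x; apply/imsetP/idP => [[i _ ->] | Ax]; first exact: enum_valP.
by exists (enum_rank_in Ax x); rewrite ?inE // enum_rankK_in.
Qed.

Lemma odd_order_even_perm (T : finType) (s : {perm T}) :
  odd #[s] -> s \in 'Alt_T.
Proof.
rewrite Alt_even => os; have := expg_order s; move/(congr1 (@odd_perm T)).
have oddX n : odd_perm (s ^+ n) = odd n && odd_perm s.
  by elim: n => [|n IH]; rewrite ?odd_perm1 // expgS odd_permM IH /=; case: (odd n); case: (odd_perm s).
by rewrite oddX os odd_perm1 /= => ->.
Qed.

(** Multiplying the first coordinate by a transposition exchanges matching and non-matching pairs,
    so exactly half of the [6 * #|K|] pairs match. This holds even if [K] has no odd element. *)
Lemma card_signmatch (K : {group {perm 'I_4}}) : #|signmatch K| = (3 * #|K|)%N.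
Proof.
pose t : {perm 'I_3} := tperm ord0 ord_max.
have ot : odd_perm t by rewrite odd_tperm.
pose h (p : S3xS4) : S3xS4 := (t * p.1, p.2).
have injh : injective h by move=> [a b] [c d] [] /mulgI-> ->.
have hC : h @: signmatch K = setX [set: {perm 'I_3}] K :\: signmatch K.
  apply/setP=> [[a b]]; apply/imsetP/idP => [[[c d]] | ].
    by rewrite !inE /= => /andP[Kd /eqP e] [-> ->]; rewrite Kd odd_permM ot e; case: (odd_perm d).
  rewrite !inE /= => /andP[ne Kb]; exists (t * a, b); last by rewrite /h /= mulgA tperm2 mul1g.
  by rewrite !inE /= odd_permM ot Kb; move: ne; rewrite Kb; case: (odd_perm a); case: (odd_perm b).
have := cardsID (signmatch K) (setX [set: {perm 'I_3}] K).
rewrite -hC card_imset // (setIidPr _); last by apply/subsetP=> p; rewrite inE => /andP[].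
have -> : #|setX [set: {perm 'I_3}] K| = (3 * #|K| + 3 * #|K|)%N.
  by rewrite cardsX (card_Sym 'I_3) card_ord -mulnDl.
by rewrite !addnn => /double_inj.
Qed.

(* The two coordinates are the affine action of G on P, with kernel 'C_S(P), and
   the projection to S followed by g. *)
Lemma signmatch_isog (gT : finGroupType) (P S G : {group gT})
    (g : {morphism S >-> {perm 'I_4}}) :
  P ><| S = G -> #|P| = 3 -> 'injm g -> #|S : 'C_S(P)| = 2 ->
  g @* 'C_S(P) \subset 'Alt_('I_4) -> ~~ (g @* S \subset 'Alt_('I_4)) ->
  G \isog signmatch (g @* S).
Proof.
move=> defG oP injg iC evC noS.
have [nPG sSG defPS nPS tiPS] := sdprod_context defG.
have [e injE imE] := set_labelling oP.
have [f3 [kf3 _ _]] := affine_perm defG injE imE.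
have sPG := normal_sub nPG.
have oddg : {in S, forall s, odd_perm (g s) = (s \notin 'C_S(P))}.
  by apply: odd_perm_index2 => //; apply: subsetIl.
have odd3 : {in S, forall s, odd_perm (f3 s) = (s \notin 'C_S(P))}.
  apply: (@odd_perm_index2 _ _ _ _ (restrm sSG f3)) => //; first exact: subsetIl.
    by rewrite morphim_restrm setIA setIid -kf3 morphim_ker sub1G.
  (* The image of [S] has order [#|S : 'C_S(P)| = 2], which does not divide the order 3 of the
     alternating group. *)
  rewrite morphim_restrm setIid; apply/negP=> /cardSg /=.
  have -> : #|f3 @* S| = 2 by rewrite card_morphim (setIidPr sSG) kf3.
  have := @card_Alt 'I_3; rewrite card_ord => /(_ isT) /eqP.
  by rewrite (_ : 3`! = (2 * 3)%N) // eqn_mul2l => /eqP->.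
have remM : {in G &, {morph remgr P S : x y / x * y}}.
  by apply: remgrM => //; apply/complP; split.
have remS x : x \in G -> remgr P S x \in S by move=> Gx; rewrite mem_remgr // defPS.
have divP x : x \in G -> divgr P S x \in P by move=> Gx; rewrite mem_divgr // defPS.
pose f x : S3xS4 := (f3 x, g (remgr P S x)).
have fM : {in G &, {morph f : x y / x * y}}.
  by move=> x y Gx Gy; rewrite /f remM // !morphM ?remS.
pose fm := Morphism fM.
(* A trivial second coordinate puts [x] in [P], a trivial first one puts it in [S], and these meet
   trivially. *)
have injf : 'injm fm.
  apply/subsetP=> x /[dup] /dom_ker Gx /mker [] f3x gx.
  have r1 : remgr P S x = 1 by apply: (injmP injg); rewrite ?remS ?group1 // gx morph1.
  have Px : x \in P by rewrite (divgr_eq P S x) r1 mulg1 divP.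
  have : x \in 'ker f3 by rewrite !inE Gx f3x /=.
  by rewrite kf3 => /setIP[Sx _]; rewrite -tiPS inE Px.
suffices <- : fm @* G = signmatch (g @* S) by apply: sub_isog.
apply/eqP; rewrite eqEcard card_signmatch card_injm // (card_injm injg) //.
rewrite -(sdprod_card defG) oP leqnn andbT.
apply/subsetP=> _ /morphimP[x _ Gx ->]; rewrite !inE /= mem_morphim ?remS //=.
(* The sign of [f3 x] depends only on the [S]-part of [x]: the [P]-part has order dividing 3, so it
   acts evenly. *)
rewrite oddg ?remS // -odd3 ?remS // {1}(divgr_eq P S x).
rewrite morphM ?(subsetP sPG _ (divP _ Gx)) ?(subsetP sSG _ (remS _ Gx)) //.
rewrite odd_permM.
have : f3 (divgr P S x) \in 'Alt_('I_3).
  apply: odd_order_even_perm; apply: (dvdn_odd (n := 3)) => //.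
  apply: dvdn_trans (morph_order _ (subsetP sPG _ (divP _ Gx))) _.
  by rewrite -oP order_dvdG ?divP.
by rewrite Alt_even => /negbTE->.
Qed.

(** Translations of a Klein four-group by nontrivial elements are double transpositions, hence even.
    The labelling of the points is free; it is spent on sending a prescribed [z] to [dtrans], so
    that the dihedral case can land in ['C[dtrans]]. *)
Lemma klein_affine (gT : finGroupType) (V M W : {group gT}) z :
  V ><| M = W -> #|V| = 4 -> {in V, forall v, v * v = 1} -> z \in V -> z != 1 ->
  exists f : {morphism W >-> {perm 'I_4}},
   [/\ 'ker f = 'C_M(V), f @* V \subset 'Alt_('I_4) & f z = dtrans].
Proof.
move=> defW oV V2 Vz ntz.
have [nVW _ _ _ _] := sdprod_context defW.
have /centsP cV : abelian V by apply: (@card_p2group_abelian _ 2).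
have [v Vv zv]: exists2 v, v \in V & v \notin [set 1; z].
  apply/subsetPn; apply/negP=> /subset_leq_card; rewrite oV cards2.
  by case: (1 != z).
move: zv; rewrite !inE negb_or => /andP[ntv vz].
(* In this order translation by [z] swaps positions 0, 1 and positions 2, 3, while translation by
   [v] swaps 0, 2 and 1, 3. *)
pose s := [:: 1; z; v; v * z].
have e1 : (v * z == 1) = false.
  by rewrite -(inj_eq (mulIg z)) -mulgA V2 // mulg1 mul1g (negbTE vz).
have e2 : (v * z == z) = false by rewrite -{2}[z]mul1g (inj_eq (mulIg z)) (negbTE ntv).
have e3 : (v * z == v) = false by rewrite -{2}[v]mulg1 (inj_eq (mulgI v)) (negbTE ntz).
have us : uniq s.
  rewrite /= !inE ![_ == v * z]eq_sym e1 e2 e3 ![1 == _]eq_sym [z == v]eq_sym.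
  by rewrite (negbTE ntz) (negbTE ntv) (negbTE vz).
pose e (i : 'I_4) := nth 1 s i.
have injE : injective e.
  by move=> i j /eqP; rewrite /e nth_uniq // => /eqP/val_inj.
have imE : e @: [set: 'I_4] = V.
  apply/eqP; rewrite eqEcard card_imset // cardsT card_ord oV leqnn andbT.
  apply/subsetP=> _ /imsetP[i _ ->]; rewrite /e.
  by case: i => [[|[|[|[|]]]]] //= _; rewrite ?groupM.
have [f [kf fV _]] := affine_perm defW injE imE.
have fz : f z = dtrans.
  apply/permP=> i; apply: injE; rewrite fV // /dtrans permM !permE /= /e.
  case: i => [[|[|[|[|]]]]] // lt; rewrite -!val_eqE /= !inordK //= ?inordK //= -?mulgA ?V2 ?mul1g ?mulg1 //.
have fv : f v = tperm (inord 0) (inord 2) * tperm (inord 1) (inord 3).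
  apply/permP=> i; apply: injE; rewrite fV // permM !permE /= /e.
  case: i => [[|[|[|[|]]]]] // lt; rewrite -!val_eqE /= !inordK //= ?inordK //=.
  - by rewrite mul1g.
  - by rewrite [_ * _]cV.
  - by rewrite V2.
  - by rewrite -mulgA [z * v]cV // mulgA V2 // mul1g.
exists f; split=> //.
have oz : odd_perm (f z) = false by rewrite fz odd_permM !odd_tperm -!val_eqE /= !inordK.
have ov : odd_perm (f v) = false by rewrite fv odd_permM !odd_tperm -!val_eqE /= !inordK.
have sVW := subsetP (normal_sub nVW).
apply/subsetP=> _ /morphimP[w _ Vw ->]; rewrite Alt_even; move: Vw.
rewrite -imE => /imsetP[i _ ->]; rewrite /e.
case: i => [[|[|[|[|]]]]] //= lt; rewrite ?morph1 ?odd_perm1 ?oz ?ov //.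
by rewrite morphM ?sVW // odd_permM oz ov.
Qed.

Lemma nonabelian_order6_isog (gT : finGroupType) (Y T S : {group gT}) :
  Y ><| T = S -> #|Y| = 3 -> #|T| = 2 -> 'C_T(Y) = 1 -> S \isog [set: {perm 'I_3}].
Proof.
move=> defS oY oT cTY; have [e injE imE] := set_labelling oY.
have [f [kf _ _]] := affine_perm defS injE imE.
have injf : 'injm f by rewrite kf cTY.
suffices <- : f @* S = [set: {perm 'I_3}] by apply: sub_isog.
apply/eqP; rewrite eqEcard subsetT card_injm // -(sdprod_card defS) oY oT.
by rewrite (card_Sym 'I_3) card_ord.
Qed.

Lemma isog_setX_dprod (gT rT1 rT2 : finGroupType) (A B G : {group gT})
    (A' : {group rT1}) (B' : {group rT2}) :
  A \x B = G -> A \isog A' -> B \isog B' -> G \isog setX A' B'.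
Proof.
move=> defG isoA isoB; apply: (isog_dprod defG (setX_dprod A' B')).
  exact: isog_trans isoA (isog_setX1 _ _).
exact: isog_trans isoB (isog_set1X _ _).
Qed.

Lemma isog_cyclic_Zp (gT : finGroupType) (A : {group gT}) n :
  1 < n -> cyclic A -> #|A| = n -> A \isog [set: 'Z_n].
Proof.
move=> n1 cA oA; rewrite isog_cyclic_card // oA cardsT card_ord Zp_cast // eqxx andbT.
by apply/cyclicP; exists Zp1; rewrite -Zp_cycle.
Qed.

(** * The listed groups *)

(** The fourth power of [x * t] kills [t] and returns [x]; the third kills [x] and returns [t]. *)
Lemma order_mul23 (gT : finGroupType) (x t : gT) :
  commute x t -> #[x] = 3 -> #[t] = 2 ->
  [/\ #[x * t] = 6, x \in <[x * t]> & t \in <[x * t]>].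
Proof.
move=> cxt ox ot; split.
- by rewrite orderM ?ox ?ot.
- suff e : (x * t) ^+ 4 = x by rewrite -{1}e mem_cycle.
  by rewrite expgMn // (expgD x 3 1) (expgD t 2 2) -{1}ox -{1 2}ot !expg_order !mul1g mulg1.
suff e : (x * t) ^+ 3 = t by rewrite -{1}e mem_cycle.
by rewrite expgMn // (expgD t 2 1) -{1}ox -{1}ot !expg_order !mul1g.
Qed.

Lemma involution_cyclic_uniq (gT : finGroupType) (H : {group gT}) s t :
  cyclic H -> s \in H -> t \in H -> #[s] = 2 -> #[t] = 2 -> s = t.
Proof.
move=> cH Hs Ht os ot; have : <[s]> == <[t]>.
  by rewrite (eq_subG_cyclic cH) ?cycle_subG // -!orderE os ot.
move/eqP=> e; have : s \in <[t]> by rewrite -e cycle_id.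
by rewrite cycle2g // !inE -order_eq1 os => /eqP.
Qed.

(** The subgroups are [<[x * s]>] and [<[x * t]>]. Both contain [x], so their intersection has order
    3 or 6, and 6 would put the distinct involutions [s] and [t] into one cyclic group. *)
Lemma cyc6_pair (gT : finGroupType) (G : {group gT}) x s t :
  x \in G -> s \in G -> t \in G -> #[x] = 3 -> #[s] = 2 -> #[t] = 2 -> s != t ->
  commute x s -> commute x t ->
  exists H K : {group gT},
    [/\ H \in cyc6_subgroups G, K \in cyc6_subgroups G & #|H :&: K| = 3].
Proof.
move=> Gx Gs Gt ox os ot nst cxs cxt.
have [oxs xs_x xs_s] := order_mul23 cxs ox os.
have [oxt xt_x xt_t] := order_mul23 cxt ox ot.
exists <[x * s]>%G, <[x * t]>%G; split.
- by rewrite inE cycle_subG groupM // cycle_cyclic -orderE oxs.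
- by rewrite inE cycle_subG groupM // cycle_cyclic -orderE oxt.
have d3 : 3 %| #|<[x * s]> :&: <[x * t]>|.
  by rewrite -ox order_dvdG // inE xs_x.
have d6 : #|<[x * s]> :&: <[x * t]>| %| 6 by rewrite -oxs cardSg ?subsetIl.
have n6 : #|<[x * s]> :&: <[x * t]>| != 6.
  apply: contraNneq nst => o6.
  have /setIidPl sub : <[x * s]> :&: <[x * t]> = <[x * s]>.
    by apply/eqP; rewrite eqEcard subsetIl o6 -orderE oxs.
  apply/eqP/(involution_cyclic_uniq (cycle_cyclic (x * t)) _ xt_t os ot).
  exact: (subsetP sub).
have : #|<[x * s]> :&: <[x * t]>| \in divisors 6 by rewrite -dvdn_divisors.
by move: d3 n6; rewrite !inE => d3 n6 /or4P[] /eqP e; rewrite e in d3 n6 *.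
Qed.

Lemma cyc6_pair_isog (gT rT : finGroupType) (G : {group gT}) (G' : {group rT}) x s t :
  G \isog G' ->
  x \in G' -> s \in G' -> t \in G' -> #[x] = 3 -> #[s] = 2 -> #[t] = 2 -> s != t ->
  commute x s -> commute x t ->
  exists H K : {group gT},
    [/\ H \in cyc6_subgroups G, K \in cyc6_subgroups G & #|H :&: K| = 3].
Proof.
rewrite isog_sym => /isogP[f injf <-] G'x G's G't ox os ot nst cxs cxt.
apply: (@cyc6_pair _ _ (f x) (f s) (f t)); rewrite ?mem_morphim ?order_injm //.
- by rewrite (inj_in_eq (injmP injf)).
- by rewrite /commute -!morphM // cxs.
- by rewrite /commute -!morphM // cxt.
Qed.

Lemma signmatch_group_set (K : {group {perm 'I_4}}) : group_set (signmatch K).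
Proof.
apply/group_setP; split=> [|[a b] [c d]]; first by rewrite !inE /= group1 !odd_perm1.
rewrite !inE /= => /andP[Kb /eqP ab] /andP[Kd /eqP cd].
by rewrite groupM //= !odd_permM ab cd.
Qed.
Canonical signmatch_group K := Group (signmatch_group_set K).

(** * Explicit permutations of four points *)

Definition dtrans' : {perm 'I_4} := tperm (inord 0) (inord 2) * tperm (inord 1) (inord 3).

Lemma dtrans_val (i : 'I_4) : dtrans i = nth 0%N [:: 1; 0; 3; 2]%N i :> nat.
Proof.
by case: i => [[|[|[|[|]]]]] // lt; rewrite permM !permE /= -!val_eqE /= !inordK //= ?inordK.
Qed.

Lemma dtrans'_val (i : 'I_4) : dtrans' i = nth 0%N [:: 2; 3; 0; 1]%N i :> nat.
Proof.
by case: i => [[|[|[|[|]]]]] // lt; rewrite permM !permE /= -!val_eqE /= !inordK //= ?inordK.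
Qed.

(** Products of permutations apply the left factor first, so this 4-cycle sends each point to its
    predecessor modulo 4. *)
Lemma cyc4_val (i : 'I_4) : cyc4 i = nth 0%N [:: 3; 0; 1; 2]%N i :> nat.
Proof.
by case: i => [[|[|[|[|]]]]] // lt; rewrite !permM !permE /= -!val_eqE /= !inordK //= ?inordK //= ?inordK.
Qed.

Definition perm4_val := (dtrans_val, dtrans'_val, cyc4_val).

Lemma dtransC : commute dtrans dtrans'.
Proof.
by apply/permP=> i; apply/val_inj; rewrite /= (permM dtrans) (permM dtrans') !perm4_val; case: i => [[|[|[|[|]]]]].
Qed.

Lemma order_dtrans : #[dtrans] = 2.
Proof.
apply: nt_prime_order => //.
  by apply/permP=> i; apply/val_inj; rewrite /= (permM dtrans dtrans) perm1 !perm4_val; case: i => [[|[|[|[|]]]]].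
by apply/eqP=> /permP/(_ ord0)/(congr1 val); rewrite /= perm1 perm4_val.
Qed.

Lemma order_dtrans' : #[dtrans'] = 2.
Proof.
apply: nt_prime_order => //.
  by apply/permP=> i; apply/val_inj; rewrite /= (permM dtrans' dtrans') perm1 !perm4_val; case: i => [[|[|[|[|]]]]].
by apply/eqP=> /permP/(_ ord0)/(congr1 val); rewrite /= perm1 perm4_val.
Qed.

Lemma order_cyc4 : #[cyc4] = 4.
Proof.
have c2 i : (cyc4 ^+ 2) i = cyc4 (cyc4 i) by exact: permM.
have c4 : cyc4 ^+ 4 = 1.
  apply/permP=> i; apply/val_inj; rewrite (expgD cyc4 2 2) (permM (cyc4 ^+ 2)) !c2 perm1 /= !perm4_val.
  by case: i => [[|[|[|[|]]]]].
have := order_dvdn cyc4 4; rewrite c4 eqxx => d4.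
have : #[cyc4] \in divisors 4 by rewrite -dvdn_divisors.
have n2 : ~~ (#[cyc4] %| 2).
  rewrite order_dvdn; apply/eqP=> /permP/(_ ord0)/(congr1 val).
  by rewrite c2 perm1 /= !perm4_val.
by rewrite !inE => /or3P[] /eqP e; rewrite e in n2 *.
Qed.

Lemma odd_cyc4 : odd_perm cyc4.
Proof. by rewrite !odd_permM !odd_tperm -!val_eqE /= !inordK. Qed.

Lemma even_dtrans : odd_perm dtrans = false.
Proof. by rewrite odd_permM !odd_tperm -!val_eqE /= !inordK. Qed.

Lemma even_dtrans' : odd_perm dtrans' = false.
Proof. by rewrite odd_permM !odd_tperm -!val_eqE /= !inordK. Qed.

Lemma dtrans_neq' : dtrans != dtrans'.
Proof. by apply/eqP=> /permP/(_ ord0)/(congr1 val); rewrite /= !perm4_val. Qed.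

Lemma order_pair1g (gT1 gT2 : finGroupType) (x : gT2) : #[(1 : gT1, x)] = #[x].
Proof. by rewrite -[RHS](order_injm (injm_pair1g gT1 gT2)) ?inE. Qed.

Lemma order_pairg1 (gT1 gT2 : finGroupType) (x : gT1) : #[(x, 1 : gT2)] = #[x].
Proof. by rewrite -[RHS](order_injm (injm_pairg1 gT1 gT2)) ?inE. Qed.

Lemma order_tperm (T : finType) (x y : T) : x != y -> #[tperm x y] = 2.
Proof.
move=> nxy; apply: nt_prime_order => //; first by rewrite expgS expg1 tperm2.
by apply/eqP=> /(congr1 (@odd_perm T)); rewrite odd_tperm nxy odd_perm1.
Qed.

Lemma perm3_order3 : exists2 c : {perm 'I_3}, #[c] = 3 & odd_perm c = false.
Proof.
have [] := @Cauchy _ 3 [set: {perm 'I_3}]%G; rewrite ?(card_Sym 'I_3) ?card_ord //.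
move=> c _ oc; exists c => //; apply/negbTE; rewrite -Alt_even.
by apply: odd_order_even_perm; rewrite oc.
Qed.

Lemma Zp_prime_order n p : 1 < n -> prime p -> p %| n -> {x : 'Z_n | #[x] = p}.
Proof.
move=> n1 pp pn; have [] := @Cauchy _ p [set: 'Z_n]%G pp; last by move=> x _; exists x.
by rewrite cardsT card_ord Zp_cast.
Qed.

(** A 3-cycle and the two double transpositions are all even, so each matches 1 in the other
    coordinate; there the 3-cycle commutes with both involutions. *)
Lemma signmatch_cyc6_pair (gT : finGroupType) (G : {group gT}) (K : {group {perm 'I_4}}) :
  dtrans \in K -> dtrans' \in K -> G \isog signmatch K ->
  exists H K : {group gT},
    [/\ H \in cyc6_subgroups G, K \in cyc6_subgroups G & #|H :&: K| = 3].
Proof.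
move=> Kd Kd' iso; have [c oc ec] := perm3_order3.
apply: (@cyc6_pair_isog _ _ G (signmatch_group K) (c, 1) (1, dtrans) (1, dtrans') iso).
- by rewrite !inE /= group1 ec odd_perm1.
- by rewrite !inE /= Kd even_dtrans odd_perm1.
- by rewrite !inE /= Kd' even_dtrans' odd_perm1.
- by rewrite order_pairg1.
- by rewrite order_pair1g order_dtrans.
- by rewrite order_pair1g order_dtrans'.
- by rewrite xpair_eqE negb_and dtrans_neq' orbT.
- by congr pair; rewrite /= ?mulg1 ?mul1g.
by congr pair; rewrite /= ?mulg1 ?mul1g.
Qed.

Lemma listed_cyc6_pair (gT : finGroupType) (G : {group gT}) :
  (G \isog G12_5 \/ G \isog G18_3 \/ G \isog G24_7 \/ G \isog G24_8 \/
    G \isog G24_14 \/ G \isog G36_11 \/ G \isog G72_43) ->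
  exists H K : {group gT},
    [/\ H \in cyc6_subgroups G, K \in cyc6_subgroups G & #|H :&: K| = 3].
Proof.
have [c oc ec] := perm3_order3.
have [z2 oz2] := @Zp_prime_order 2 2 isT isT isT.
have [z3 oz3] := @Zp_prime_order 3 3 isT isT isT.
have neq1 (rT : finGroupType) (x : rT) : #[x] = 2 -> (x == 1) = false.
  by move=> ox; rewrite -order_eq1 ox.
case=> [iso|[iso|[iso|[iso|[iso|[iso|iso]]]]]].
- have [s os] := @Zp_prime_order 6 2 isT isT isT.
  have [x ox] := @Zp_prime_order 6 3 isT isT isT.
  apply: (@cyc6_pair_isog _ _ G [set: 'Z_2 * 'Z_6]%G (1, x) (z2, 1) (1, s) iso);
    rewrite ?inE ?order_pair1g ?order_pairg1 //.
  + by rewrite xpair_eqE (neq1 _ z2).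
  + by congr pair; rewrite /= ?mulg1 ?mul1g.
  by congr pair; rewrite /= Zp_mulgC.
- pose t1 : {perm 'I_3} := tperm ord0 (inord 1).
  pose t2 : {perm 'I_3} := tperm ord0 (inord 2).
  have ot1 : #[t1] = 2 by rewrite order_tperm // -val_eqE /= inordK.
  have ot2 : #[t2] = 2 by rewrite order_tperm // -val_eqE /= inordK.
  apply: (@cyc6_pair_isog _ _ G [set: 'Z_3 * {perm 'I_3}]%G (z3, 1) (1, t1) (1, t2) iso);
    rewrite ?inE ?order_pair1g ?order_pairg1 //.
  + rewrite xpair_eqE eqxx /=; apply/eqP=> /permP/(_ ord0)/(congr1 val).
    by rewrite !tpermL /= !inordK.
  + by congr pair; rewrite /= ?mulg1 ?mul1g.
  by congr pair; rewrite /= ?mulg1 ?mul1g.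
(* The cyclic group [<[cyc4]>] has a single involution, so the second one is taken from the factor
   ['Z_2]. *)
- have c2even : odd_perm (cyc4 ^+ 2) = false by rewrite odd_permM addbb.
  have oc2 : #[cyc4 ^+ 2] = 2 by rewrite orderXdiv order_cyc4.
  apply: (@cyc6_pair_isog _ _ G (setX_group [set: 'Z_2]%G (signmatch_group <[cyc4]>))
    (1, (c, 1)) (z2, (1, 1)) (1, (1, cyc4 ^+ 2)) iso).
  + by rewrite !inE /= group1 ec odd_perm1.
  + by rewrite !inE /= group1 !odd_perm1.
  + by rewrite !inE /= mem_cycle c2even odd_perm1.
  + by rewrite order_pair1g order_pairg1.
  + by rewrite order_pairg1.
  + by rewrite !order_pair1g.
  + by rewrite xpair_eqE (neq1 _ z2).
  + by congr (_, (_, _)); rewrite /= ?mulg1 ?mul1g.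
  by congr (_, (_, _)); rewrite /= ?mulg1 ?mul1g.
- apply: (signmatch_cyc6_pair _ _ iso); first by apply/cent1P.
  by apply/cent1P/commute_sym/dtransC.
- apply: (@cyc6_pair_isog _ _ G [set: 'Z_2 * 'Z_2 * {perm 'I_3}]%G
    ((1, 1), c) ((z2, 1), 1) ((1, z2), 1) iso);
    rewrite ?inE ?order_pair1g ?order_pairg1 ?order_pair1g //.
  + by rewrite !xpair_eqE (neq1 _ z2).
  + by congr (_, _, _); rewrite /= ?mulg1 ?mul1g.
  by congr (_, _, _); rewrite /= ?mulg1 ?mul1g.
- apply: (@cyc6_pair_isog _ _ G (setX_group [set: 'Z_3]%G ('Alt_('I_4))%G)
    (z3, 1) (1, dtrans) (1, dtrans') iso).
  + by rewrite inE /= inE group1.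
  + by rewrite inE /= inE Alt_even even_dtrans.
  + by rewrite inE /= inE Alt_even even_dtrans'.
  + by rewrite order_pairg1.
  + by rewrite order_pair1g order_dtrans.
  + by rewrite order_pair1g order_dtrans'.
  + by rewrite xpair_eqE negb_and dtrans_neq' orbT.
  + by congr pair; rewrite /= ?mulg1 ?mul1g.
  by congr pair; rewrite /= ?mulg1 ?mul1g.
by apply: (@signmatch_cyc6_pair _ _ [set: {perm 'I_4}]%G _ _ iso); rewrite inE.
Qed.

(** * Structure of a group with two such subgroups *)

Section Structure.

Variables (gT : finGroupType) (G : {group gT}).

Hypothesis ordG : {in G, forall x, #[x] \in [:: 1; 2; 3; 4; 6]%N}.

Lemma common_order3_cycle :
  #|cyc6_subgroups G| = 3 ->
  (exists H K : {group gT},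
    [/\ H \in cyc6_subgroups G, K \in cyc6_subgroups G & #|H :&: K| = 3]) ->
  exists2 x, x \in G /\ #[x] = 3
    & {in G, forall z, #[z] = 6 -> x \in <[z]>} /\
      #|[set t in 'C_G[x] | #[t] == 2]| = 3.
Proof.
set J := cyc6_subgroups G => oJ [H] [K] []; rewrite !inE.
case/and3P=> sHG cH /eqP oH; case/and3P=> sKG cK /eqP oK oHK.
have /cyclicP[x defP] : cyclic (H :&: K) by apply: prime_cyclic; rewrite oHK.
have ox : #[x] = 3 by rewrite orderE -defP.
have /setIP[Hx Kx] : x \in H :&: K by rewrite defP cycle_id.
have Gx := subsetP sHG x Hx; exists x => //.
set I := [set t in 'C_G[x] | #[t] == 2].
have ItP t : reflect [/\ t \in G, commute x t & #[t] = 2] (t \in I).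
  rewrite inE in_setI; apply: (iffP idP) => [/andP[/andP[Gt c] /eqP o] | [-> c ->]].
    by split=> //; apply/commute_sym/cent1P.
  by rewrite eqxx andbT; apply/cent1P/commute_sym.
have invol (L : {group gT}) : L \subset G -> cyclic L -> #|L| = 6 -> x \in L ->
    exists2 t, t \in I & t \in L.
  move=> sLG cL oL Lx; have [||t Lt ot] := @Cauchy _ 2 L; rewrite ?oL //.
  exists t => //; apply/ItP; rewrite (subsetP sLG) //; split=> //.
  by apply: (centsP (cyclic_abelian cL)).
have [s Is Hs] := invol H sHG cH oH Hx.
have [t It Kt] := invol K sKG cK oK Kx.
have /ItP[Gs _ os] := Is; have /ItP[Gt _ ot] := It.
have nst : s != t.
  apply: contraTneq isT => est; have : #[s] %| 3 by rewrite -oHK order_dvdG // inE Hs est.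
  by rewrite os.
pose phi u := <[x * u]>%G.
have injphi : {in I &, injective phi}.
  move=> u v /ItP[_ cu ou] /ItP[_ cv ov] /(congr1 val) /= euv.
  have [_ _ uu] := order_mul23 cu ox ou; have [_ _ vv] := order_mul23 cv ox ov.
  by rewrite euv in uu; apply: (involution_cyclic_uniq (cycle_cyclic (x * v))).
pose J' := [set L in J | x \in (L : {group gT})].
have sJ' : J' \subset J by apply/subsetP=> L; rewrite inE => /andP[].
have sphi : phi @: I \subset J'.
  apply/subsetP=> _ /imsetP[u /ItP[Gu cu ou] ->].
  have [o6 xx _] := order_mul23 cu ox ou.
  by rewrite inE inE /= cycle_subG groupM // cycle_cyclic -orderE o6 xx.
have leI : #|I| <= #|J'| by rewrite -(card_in_imset injphi) subset_leq_card.
have leJ := subset_leq_card sJ'.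
have oI : #|I| = 3.
  have leI3 : #|I| <= 3 by rewrite -oJ (leq_trans leI).
  have geI2 : 2 <= #|I|.
    rewrite (_ : 2 = #|[set s; t]|); last by rewrite cards2 nst.
    by apply: subset_leq_card; apply/subsetP=> u /set2P[] ->.
  (* Frobenius' theorem makes the number of solutions of [u ^+ 2 = 1] in the centraliser even.
     Removing 1 leaves an odd number of involutions, and it lies between 2 and 3. *)
  have : 2 %| #|'Ldiv_2('C_G[x])|.
    apply: Frobenius_Ldiv; rewrite -os order_dvdG //.
    by have := Is; rewrite inE => /andP[].
  have -> : 'Ldiv_2('C_G[x]) = 1 |: I.
    apply/setP=> u; rewrite in_setI in_setU1 [u \in I]inE [u \in 'Ldiv_2()]inE -order_dvdn.
    have -> : (#[u] %| 2) = (u == 1) || (#[u] == 2)%N.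
      by rewrite -order_eq1 dvdn_divisors // !inE.
    by rewrite andb_orr; case: eqP => [->|]; rewrite ?group1 ?andbF.
  rewrite cardsU1 [1 \in I]inE order1 andbF.
  by case: #|I| leI3 geI2 => [|[|[|[|]]]].
split=> // z Gz oz.
(* Three involutions already yield three cyclic subgroups through [x], and [J] has no others. *)
have defJ' : J' = J by apply/eqP; rewrite eqEcard sJ' oJ -oI.
have : <[z]>%G \in J by rewrite inE cycle_subG Gz cycle_cyclic -orderE oz.
by rewrite -defJ' inE => /andP[].
Qed.

(** By Cauchy, a prime dividing [#|A|] is the order of an element, so it is 2 or 3, and the part of
    the order prime to 2 is the 3-part. *)
Lemma card_pi23 (A : {group gT}) : A \subset G -> #|A| = (#|A|`_2 * #|A|`_3)%N.
Proof.
move=> sAG; rewrite -{1}(partnC 2 (cardG_gt0 A)); congr (_ * _)%N.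
apply: eq_in_partn => p; rewrite mem_primes => /and3P[pp _ /(Cauchy pp)[a Aa oa]].
have := ordG (subsetP sAG a Aa); rewrite oa !inE => pl.
by case/or4P: pl pp => [/eqP->|/eqP->|/eqP->|/orP[]/eqP->].
Qed.

(** * The centraliser of [x] and its order *)

Variable x : gT.
Hypotheses (Gx : x \in G) (ox : #[x] = 3).
Hypothesis sub6 : {in G, forall z, #[z] = 6 -> x \in <[z]>}.
Let C := 'C_G[x]%G.
Let I := [set t in 'C_G[x] | #[t] == 2].
Hypothesis oI : #|I| = 3.

Let sCG : C \subset G. Proof. exact: subsetIl. Qed.

Lemma cent1xP t : reflect (t \in G /\ commute x t) (t \in C).
Proof.
apply: (iffP setIP) => [[Gt /cent1P c] | [Gt c]]; split=> //.
by apply/cent1P/commute_sym.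
Qed.

Let Cx : x \in C. Proof. by apply/cent1xP. Qed.

Let sPC : <[x]> \subset C. Proof. by rewrite cycle_subG. Qed.

(** The product [y * s] has order 6, so [<[y * s]>] contains [x] by [sub6]; a cyclic group has only
    one subgroup of order 3. This is the source of most contradictions below. *)
Lemma order3_comm_involution y s :
  y \in G -> s \in G -> #[y] = 3 -> #[s] = 2 -> commute y s ->
  y \in <[x]> /\ s \in C.
Proof.
move=> Gy Gs oy os cys; have [o6 yy _] := order_mul23 cys oy os.
have xx := sub6 (groupM Gy Gs) o6.
have /eqP eyx : <[y]> == <[x]>.
  by rewrite (eq_subG_cyclic (cycle_cyclic (y * s))) ?cycle_subG // -!orderE oy ox.
split; first by rewrite -eyx cycle_id.
apply/cent1xP; split=> //.
have /cycleP[k ->] : x \in <[y]> by rewrite eyx cycle_id.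
exact/commute_sym/commuteX/commute_sym.
Qed.

(** Otherwise [x * c] would have order 12. *)
Lemma cent_no_order4 c : c \in C -> #[c] != 4.
Proof.
case/cent1xP=> Gc cxc; apply/eqP=> oc.
have := ordG (groupM Gx Gc); rewrite orderM ?ox ?oc //.
Qed.

(** For an involution [t] commuting with [x], any conjugate of [<[x * t]>] is again cyclic of order
    6, so it contains [x]; its only subgroup of order 3 is then both [<[x]>] and the conjugate of
    [<[x]>]. *)
Lemma cycle_normal : <[x]> <| G.
Proof.
rewrite /normal cycle_subG Gx /=.
have /card_gt0P[t] : 0 < #|I| by rewrite oI.
rewrite inE => /andP[/cent1xP[Gt cxt] /eqP ot].
have [o6 xx _] := order_mul23 cxt ox ot.
apply/normsP=> g Gg; have o6g : #[(x * t) ^ g] = 6 by rewrite orderJ.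
have x6 : x \in <[(x * t) ^ g]> by rewrite sub6 // memJ_norm ?groupM // (subsetP (normG _)).
apply/eqP; rewrite (eq_subG_cyclic (cycle_cyclic ((x * t) ^ g))) ?cycle_subG //.
  by rewrite cardJg.
by rewrite /= cycleJ conjSg cycle_subG.
Qed.

(** By normality the conjugates of [x] are among the two generators of [<[x]>]. *)
Lemma index_cent_le2 (A : {group gT}) : A \subset G -> #|A : 'C_A[x]| <= 2.
Proof.
move=> sAG; rewrite index_cent1 (_ : 2 = #|<[x]>^#|); last first.
  by have := ox; rewrite orderE (cardsD1 1 <[x]>) group1 add1n => -[->].
apply: subset_leq_card; apply/subsetP=> _ /imsetP[g Ag ->].
rewrite !inE -order_eq1 orderJ ox /= memJ_norm ?cycle_id //.
exact: (subsetP (normal_norm cycle_normal)) (subsetP sAG g Ag).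
Qed.

Lemma index_cent2 (A : {group gT}) u :
  A \subset G -> u \in A -> u \notin C -> #|A : 'C_A(<[x]>)| = 2.
Proof.
move=> sAG Au nCu; rewrite cent_cycle.
have := index_cent_le2 sAG; have := indexg_gt0 A 'C_A[x].
case e: #|A : 'C_A[x]| => [|[|[|]]] // _ _; case/negP: nCu.
have := index1g (subsetIl A 'C[x]) e; move/setP/(_ u); rewrite Au => /setIP[_ cu].
by rewrite inE (subsetP sAG).
Qed.

Lemma Sylow2_involutions (R : {group gT}) :
  2.-Sylow(C) R -> R \subset 1 |: I.
Proof.
move=> sylR; have sRC := pHall_sub sylR; have pR := pHall_pgroup sylR.
apply/subsetP=> r Rr; rewrite in_setU1 inE (subsetP sRC) //= -order_eq1.
have Cr := subsetP sRC r Rr.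
have := mem_p_elt pR Rr; have := cent_no_order4 Cr; have := ordG (subsetP sCG r Cr).
rewrite /p_elt !inE => /or4P[|||/orP[]] /eqP -> //.
Qed.

(** A Sylow 2-subgroup of [C] lies in [1 |: I], which has four elements, and it is nontrivial
    because [I] is not empty. *)
Lemma card_cent_part2 : (#|C|`_2 = 2 \/ #|C|`_2 = 4)%N.
Proof.
have [R sylR] := Sylow_exists 2 C; rewrite -(card_Hall sylR).
have : #|R| <= 4.
  apply: leq_trans (subset_leq_card (Sylow2_involutions sylR)) _.
  by rewrite cardsU1 oI; case: (1 \notin I).
have /card_gt0P[t] : 0 < #|I| by rewrite oI.
rewrite inE => /andP[Ct /eqP ot].
have d2 : 2 %| #|C| by rewrite -ot order_dvdG.
rewrite (card_Hall sylR) p_part.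
have : 0 < logn 2 #|C| by rewrite logn_gt0 mem_primes cardG_gt0 d2.
case: (logn 2 #|C|) => [|[|[|k]]] // _ le4; [by left | by right | move: le4].
rewrite !expnS -[4%N]/(2 * (2 * 1))%N !leq_pmul2l //.
have : (0 < 2 ^ k)%N by rewrite expn_gt0.
by case: (2 ^ k)%N => // n _; rewrite mulnS.
Qed.

Lemma order_3elt y : y \in G -> 3.-elt y -> y != 1 -> #[y] = 3.
Proof.
move=> Gy py; rewrite -order_eq1; have := ordG Gy; move: py; rewrite /p_elt !inE.
by move=> py /or4P[|||/orP[]] /eqP e; rewrite e in py *.
Qed.

(** [C] permutes its three involutions by conjugation, so the centraliser [D] of one of them has
    index at most 3. Elements of order 3 in [D] commute with an involution, hence lie in [<[x]>],
    and the 3-part of [#|D|] is 3. *)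
Lemma card_cent_part3 : (#|C|`_3 = 3 \/ #|C|`_3 = 9)%N.
Proof.
have /card_gt0P[t] : 0 < #|I| by rewrite oI.
rewrite inE => /andP[Ct /eqP ot]; have /cent1xP[Gt cxt] := Ct.
pose D := 'C_C[t]%G; have sDC : D \subset C := subsetIl _ _.
have Dx : x \in D by rewrite inE Cx; apply/cent1P.
have oD : (#|D|`_3 = 3)%N.
  have [Q sylQ] := Sylow_exists 3 D; rewrite -(card_Hall sylQ).
  apply/eqP; rewrite eqn_leq; apply/andP; split; last first.
    have d3 : 3 %| #|D| by rewrite -ox order_dvdG.
    have := partn_dvd 3 (cardG_gt0 D) d3; rewrite -(card_Hall sylQ) part_pnat_id //.
    by move/dvdn_leq->.
  rewrite -ox orderE; apply: subset_leq_card; apply/subsetP=> y Qy.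
  have [-> | nty] := eqVneq y 1; first exact: group1.
  have Dy := subsetP (pHall_sub sylQ) y Qy; have Cy := subsetP sDC y Dy.
  have Gy := subsetP sCG y Cy.
  have oy := order_3elt Gy (mem_p_elt (pHall_pgroup sylQ) Qy) nty.
  have cyt : commute y t by have /setIP[_ /cent1P] := Dy.
  by have [] := order3_comm_involution Gy Gt oy ot cyt.
have iD : #|C : D| <= 3.
  rewrite index_cent1 -oI; apply: subset_leq_card; apply/subsetP=> _ /imsetP[c Cc ->].
  by rewrite inE orderJ ot eqxx andbT groupJ.
have := partnM 3 (cardG_gt0 D) (indexg_gt0 C D); rewrite Lagrange // oD.
by case: #|C : D| (indexg_gt0 C D) iD => [|[|[|[|]]]] // _ _ ->;
  rewrite p_part; [by left | by left | by right].
Qed.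

Lemma cent_full_or_index2 : C :=: G \/ exists2 u, u \in G & u \notin C.
Proof.
have [sGC | /subsetPn[u Gu nCu]] := boolP (G \subset C); last by right; exists u.
by left; apply/eqP; rewrite eqEsubset sCG.
Qed.

Lemma card_index2 u : u \in G -> u \notin C -> #|G : C| = 2 /\ #|G| = (2 * #|C|)%N.
Proof.
move=> Gu nCu; have := index_cent2 (subxx G) Gu nCu; rewrite cent_cycle => iC.
by split=> //; rewrite -(Lagrange sCG) mulnC iC.
Qed.

(** * Sylow 3-subgroups of [C] of order 9 *)

Section Order9.

Variable Q : {group gT}.
Hypotheses (sylQ : 3.-Sylow(C) Q) (C9 : (#|C|`_3 = 9)%N).

Let oQ : #|Q| = 9. Proof. by rewrite (card_Hall sylQ). Qed.

Let sQC : Q \subset C. Proof. exact: pHall_sub sylQ. Qed.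

Lemma Sylow3_cycle : x \in Q.
Proof.
have nPC : <[x]> <| C by apply: normalS cycle_normal => //.
rewrite -cycle_subG; apply: (normal_sub_max_pgroup (Hall_max sylQ)) => //.
by rewrite /pgroup -orderE ox.
Qed.

Lemma Sylow3_abelian : abelian Q.
Proof. exact: (@card_p2group_abelian _ 3). Qed.

Lemma Sylow3_order y : y \in Q -> y != 1 -> #[y] = 3.
Proof.
move=> Qy; apply: order_3elt; first exact: (subsetP (subset_trans sQC sCG)).
exact: mem_p_elt (pHall_pgroup sylQ) Qy.
Qed.

Lemma Sylow3_dprod y : y \in Q -> y \notin <[x]> -> <[x]> \x <[y]> = Q.
Proof.
move=> Qy nxy; have nty : y != 1 by apply: contraNneq nxy => ->; apply: group1.
have oy := Sylow3_order Qy nty.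
have ti : <[x]> :&: <[y]> = 1.
  by rewrite setIC prime_TIg -?orderE ?oy // cycle_subG.
have cxy : <[y]> \subset 'C(<[x]>).
  by apply: (sub_abelian_cent2 Sylow3_abelian); rewrite cycle_subG ?Sylow3_cycle.
rewrite dprodE //; apply/eqP; rewrite eqEcard mul_subG ?cycle_subG ?Sylow3_cycle //=.
by rewrite TI_cardMg // -!orderE ox oy oQ.
Qed.

Lemma Sylow3_no_involution y s :
  y \in Q -> y \notin <[x]> -> s \in G -> commute y s -> #[s] != 2.
Proof.
move=> Qy nxy Gs cys; have nty : y != 1 by apply: contraNneq nxy => ->; apply: group1.
apply/eqP=> os; have oy := Sylow3_order Qy nty; case/negP: nxy.
by have [] := order3_comm_involution (subsetP (subset_trans sQC sCG) y Qy) Gs oy os cys.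
Qed.

Lemma Sylow3_supplement : exists2 y, y \in Q & y \notin <[x]>.
Proof.
by apply/subsetPn; apply/negP=> /subset_leq_card; rewrite oQ -orderE ox.
Qed.

End Order9.

Lemma order3_cycleP (y z : gT) : #[y] = 3 -> z \in <[y]> -> [\/ z = 1, z = y | z = y^-1].
Proof.
move=> oy /cyclePmin[k]; rewrite oy => lk ->.
case: k lk => [|[|[|]]] // _; [by constructor 1 | by constructor 2 | constructor 3].
by apply: (mulgI y); rewrite mulgV -expgS; have := expg_order y; rewrite oy.
Qed.

Lemma odd_inv_fix (H : {group gT}) z : odd #|H| -> z \in H -> z^-1 = z -> z = 1.
Proof.
move=> oH Hz zz; have z2 : z ^+ 2 = 1 by rewrite expgS expg1 -{1}zz mulVg.
have : #[z] \in divisors 2 by rewrite -dvdn_divisors // order_dvdn z2.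
have := dvdn_odd (order_dvdG Hz) oH.
by rewrite !inE => oz /orP[] /eqP e; [apply/eqP; rewrite -order_eq1 e | rewrite e in oz].
Qed.

(** A 3-part equal to 3 would make [C] cyclic of order 6, with one involution instead of three. So
    [#|C| = 18], and [C] splits as [<[x]>] times a nonabelian group of order 6 generated by [t] and
    an element [y] that [t] inverts. *)
Lemma isog_Z3S3 : (#|C|`_2 = 2)%N -> G \isog G18_3.
Proof.
move=> C2; have [R sylR] := Sylow_exists 2 C.
have oR : #|R| = 2 by rewrite (card_Hall sylR).
have [|t Rt ot] := @Cauchy _ 2 R isT; rewrite ?oR //.
have sRC := pHall_sub sylR; have Ct := subsetP sRC t Rt.
have /cent1xP[Gt cxt] := Ct.
have oC := card_pi23 sCG; rewrite C2 in oC.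
case: card_cent_part3 => C3.
  rewrite C3 in oC; have [o6 _ _] := order_mul23 cxt ox ot.
  have defC : <[x * t]> = C.
    by apply/eqP; rewrite eqEcard cycle_subG groupM //= -orderE o6 oC.
  suff /subset_leq_card : I \subset [set t] by rewrite oI cards1.
  apply/subsetP=> s; rewrite [s \in I]inE => /andP[Cs /eqP os]; rewrite inE; apply/eqP.
  have cC : cyclic C by rewrite -defC cycle_cyclic.
  exact: (involution_cyclic_uniq cC).
rewrite C3 in oC; have [Q sylQ] := Sylow_exists 3 C.
have oQ : #|Q| = 9 by rewrite (card_Hall sylQ).
have sQC := pHall_sub sylQ.
have nQC : Q <| C.
  by apply: index2_normal => //; rewrite -divgS // oC oQ.
have cQ := Sylow3_abelian sylQ C3; have Qx := Sylow3_cycle sylQ.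
have [q Qq nxq] := Sylow3_supplement sylQ C3.
have Qqt : q ^ t \in Q by rewrite memJ_norm // (subsetP (normal_norm nQC)).
have comQ := centsP cQ.
(* This commutator is inverted by [t] because [t * t = 1]. If it lay in [<[x]>] it would also be
   fixed by [t], hence trivial, and [q] would commute with an involution. *)
pose y := q^-1 * q ^ t; have Qy : y \in Q by rewrite groupM ?groupV.
have t2 : t * t = 1 by rewrite -(expg_order t) ot.
have yt : y ^ t = y^-1.
  by rewrite /y conjMg conjVg -conjgM t2 conjg1 (invMg q^-1) invgK.
have xt : x ^ t = x by apply/conjg_fixP/commgP.
have nxy : y \notin <[x]>.
  apply: contra (nxq) => /cycleP[k ek].
  have yy : y ^ t = y by rewrite ek conjXg xt.
  have y1 : y = 1 by apply: (odd_inv_fix (H := Q)); rewrite ?oQ // -yt.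
  have cqt : commute q t.
    by apply/commgP/conjg_fixP/eqP; rewrite eq_sym eq_mulVg1 -/y y1.
  have ntq : q != 1 by apply: contraNneq (nxq) => ->; apply: group1.
  have oq := Sylow3_order sylQ Qq ntq.
  by have [] := order3_comm_involution (subsetP (subset_trans sQC sCG) q Qq) Gt oq ot cqt.
have nty : y != 1 by apply: contraNneq nxy => ->; apply: group1.
have oy := Sylow3_order sylQ Qy nty.
have oT : #|<[t]>| = 2 by [].
have nyt : <[t]> \subset 'N(<[y]>).
  by rewrite cycle_subG; apply/normP/eqP; rewrite eqEcard cardJg leqnn andbT -cycleJ yt cycle_subG groupV cycle_id.
have tiyt : <[y]> :&: <[t]> = 1 by rewrite coprime_TIg // -!orderE oy ot.
pose S := (<[y]> <*> <[t]>)%G.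
have defS : <[y]> ><| <[t]> = S by rewrite sdprodEY.
have oS : #|S| = 6 by rewrite -(sdprod_card defS) -!orderE oy ot.
have cT : 'C_<[t]>(<[y]>) = 1.
  apply: prime_TIg; rewrite ?oT // cycle_subG /= cent_cycle; apply/cent1P => cty.
  have := Sylow3_no_involution sylQ Qy nxy Gt (commute_sym cty).
  by rewrite ot.
have isoS := nonabelian_order6_isog defS oy oT cT.
have dxy := Sylow3_dprod sylQ C3 Qy nxy.
have Sy : y \in S by rewrite -cycle_subG joing_subl.
have tiS : <[x]> :&: S = 1.
  apply: prime_TIg; rewrite -?orderE ?ox //; apply/negP=> Sx.
  have sQS : Q \subset S by rewrite -(dprodW dxy) mul_subG // cycle_subG.
  by have := cardSg sQS; rewrite oQ oS.
have sSC : S \subset C by rewrite join_subG !cycle_subG Ct (subsetP sQC).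
have defC : <[x]> \x S = C.
  rewrite dprodE //; last by rewrite cent_cycle (subset_trans sSC) ?subsetIr.
  by apply/eqP; rewrite eqEcard mul_subG //= TI_cardMg // -orderE ox oS oC.
case: cent_full_or_index2 => [eCG | [u0 Gu0 nCu0]].
  have -> : G18_3 = setX [set: 'Z_3] [set: {perm 'I_3}] by apply/setP=> p; rewrite !inE.
  apply: (isog_setX_dprod (A := <[x]>%G) (B := S)); rewrite -?eCG //.
  by apply: isog_cyclic_Zp => //; rewrite cycle_cyclic.
(* If C had index 2, then u or u * t, for u in a Sylow 2-subgroup of G outside C,
   would centralise y, giving an element of order 6 or 12 that cannot exist. *)
have [iC oG] := card_index2 Gu0 nCu0; rewrite oC in oG.
have nCG : C <| G by apply: index2_normal.
have nQG : Q <| G.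
  by rewrite -(normal_Hall_pcore sylQ nQC); apply: gFnormal_trans.
have p2R : 2.-group R by rewrite /pgroup oR.
have [W sylW sRW] := Sylow_superset (subset_trans sRC sCG) p2R.
have oW : #|W| = 4 by rewrite (card_Hall sylW) oG p_part.
have cW : abelian W by apply: (@card_p2group_abelian _ 2).
have sWG := pHall_sub sylW.
have [u Wu nCu] : exists2 u, u \in W & u \notin C.
  apply/subsetPn; apply/negP=> sWC; have := cardSg sWC; by rewrite oC oW.
have Wt := subsetP sRW t Rt; have Gu := subsetP sWG u Wu.
have fixW w : w \in W -> w \notin C -> y ^ w <> y.
  move=> Ww nCw /conjg_fixP/commgP cyw; have Gw := subsetP sWG w Ww.
  have Gy := subsetP (subset_trans sQC sCG) y Qy.
  have := mem_p_elt (pHall_pgroup sylW) Ww; have := ordG Gw.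
  rewrite /p_elt !inE => /or4P[|||/orP[]] /eqP ow; rewrite ow // => _.
  - by case/negP: nCw; move/eqP: ow; rewrite order_eq1 => /eqP->.
  - by have := Sylow3_no_involution sylQ Qy nxy Gw cyw; rewrite ow.
  by have := ordG (groupM Gy Gw); rewrite orderM ?oy ?ow.
have Qyu : y ^ u \in Q by rewrite memJ_norm // (subsetP (normal_norm nQG)).
(* Since [t] fixes [<[x]>] and inverts [<[y]>], an element of [Q] inverted by [t] has trivial
   component in [<[x]>]; hence [y ^ u] is [y] or its inverse. *)
have yut : (y ^ u) ^ t = (y ^ u)^-1.
  have cut : u * t = t * u by apply: (centsP cW).
  by rewrite -conjgM cut conjgM yt conjVg.
have [a [b [xa yb eab _]]] := mem_dprod dxy Qyu.
have Qa : a \in Q by rewrite (subsetP _ _ xa) // cycle_subG.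
have Qb : b \in Q by rewrite (subsetP _ _ yb) // cycle_subG.
have at1 : a ^ t = a by have /cycleP[k ->] := xa; rewrite conjXg xt.
have bt : b ^ t = b^-1 by have /cycleP[k ->] := yb; rewrite conjXg yt expgVn.
have a1 : a = 1.
  apply: (odd_inv_fix (H := Q)); rewrite ?oQ //.
  move: yut; rewrite eab conjMg at1 bt invMg (comQ b^-1) ?groupV //.
  by move/mulIg.
have yyu : y ^ u \in <[y]> by rewrite eab a1 mul1g.
have ntyu : y ^ u != 1 by rewrite -order_eq1 orderJ oy.
have nCut : u * t \notin C by rewrite groupMr.
case: (order3_cycleP oy yyu) => [e | e | e].
- by rewrite e eqxx in ntyu.
- by case: (fixW u).
by case: (fixW (u * t) (groupM Wu Wt) nCut); rewrite conjgM e conjVg yt invgK.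
Qed.

(** * Sylow 2-subgroup of [C] of order 4 *)

Section Klein.

Variable V : {group gT}.
Hypotheses (sylV : 2.-Sylow(C) V) (C4 : (#|C|`_2 = 4)%N).

Let oV : #|V| = 4. Proof. by rewrite (card_Hall sylV). Qed.

Let sVC : V \subset C. Proof. exact: pHall_sub sylV. Qed.

Let sVG : V \subset G. Proof. exact: subset_trans sVC sCG. Qed.

Lemma klein_involutions : V = 1 |: I :> {set gT}.
Proof.
apply/eqP; rewrite eqEcard Sylow2_involutions //= cardsU1 oI oV.
by case: (1 \notin I).
Qed.

Lemma mem_klein t : t \in C -> #[t] = 2 -> t \in V.
Proof. by move=> Ct ot; rewrite klein_involutions in_setU1 [t \in I]inE Ct ot orbT. Qed.

Lemma klein_order t : t \in V -> t != 1 -> #[t] = 2.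
Proof.
by rewrite klein_involutions in_setU1 [t \in I]inE => /orP[->//|/andP[_ /eqP]].
Qed.

Lemma klein_square : {in V, forall t, t * t = 1}.
Proof.
move=> t Vt; have [-> | ntt] := eqVneq t 1; first by rewrite mulg1.
by have := expg_order t; rewrite klein_order.
Qed.

Lemma klein_abelian : abelian V. Proof. exact: (@card_p2group_abelian _ 2). Qed.

(** [V] contains every involution of [C], and [C] is normal in [G] as the centraliser of the normal
    subgroup [<[x]>]. *)
Lemma klein_normal : V <| G.
Proof.
rewrite /normal sVG /=; apply/subsetP=> g Gg; rewrite inE; apply/subsetP=> _ /imsetP[t Vt ->].
have [-> | ntt] := eqVneq t 1; first by rewrite conj1g.
have nCG : C <| G.
  have := subcent_normal G <[x]>; rewrite cent_cycle.
  by rewrite (setIidPl (normal_norm cycle_normal)).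
apply: mem_klein; last by rewrite orderJ klein_order.
by rewrite memJ_norm ?(subsetP sVC) // (subsetP (normal_norm nCG)).
Qed.

Lemma klein_pick : exists2 z, z \in V & z != 1.
Proof. by apply/trivgPn; rewrite trivg_card1 oV. Qed.

Lemma isog_Z2Z6 : (#|C|`_3 = 3)%N -> C :=: G -> G \isog G12_5.
Proof.
move=> C3 eCG; have oC := card_pi23 sCG; rewrite C4 C3 in oC.
have [s Vs nts] := klein_pick.
have [t Vt nst] : exists2 t, t \in V & t \notin <[s]>.
  by apply/subsetPn; apply/negP=> /subset_leq_card; rewrite oV -orderE klein_order.
have ntt : t != 1 by apply: contraNneq nst => ->; apply: group1.
have os := klein_order Vs nts; have ot := klein_order Vt ntt.
have /cent1xP[Gt cxt] := subsetP sVC t Vt; have /cent1xP[Gs cxs] := subsetP sVC s Vs.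
have [o6 _ txt] := order_mul23 cxt ox ot.
have ti : <[s]> :&: <[x * t]> = 1.
  apply: prime_TIg; rewrite -?orderE ?os // cycle_subG; apply: contra nst => sxt.
  by rewrite -(involution_cyclic_uniq (cycle_cyclic _) sxt txt os ot) cycle_id.
have cst : commute s t by apply: (centsP klein_abelian).
have defG : <[s]> \x <[x * t]> = G.
  rewrite dprodE //; last first.
    by rewrite cent_cycle cycle_subG; apply/cent1P/commute_sym/commuteM.
  apply/eqP; rewrite eqEcard mul_subG ?cycle_subG ?groupM //= TI_cardMg // -!orderE os o6.
  by rewrite -eCG oC.
have -> : G12_5 = setX [set: 'Z_2] [set: 'Z_6] by apply/setP=> p; rewrite !inE.
by apply: (isog_setX_dprod defG); apply: isog_cyclic_Zp; rewrite ?cycle_cyclic.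
Qed.

Lemma card_Alt4 : #|'Alt_('I_4)| = 12.
Proof.
have := @card_Alt 'I_4; rewrite card_ord => /(_ isT) /eqP.
by rewrite (_ : 4`! = (2 * 12)%N) // eqn_mul2l => /eqP.
Qed.

(** * Centraliser of order 36 *)

Section Nine.

Hypothesis C9 : (#|C|`_3 = 9)%N.

Let oC : #|C| = 36. Proof. by rewrite (card_pi23 sCG) C4 C9. Qed.

Variables (Q : {group gT}) (y : gT).
Hypotheses (sylQ : 3.-Sylow(C) Q) (Qy : y \in Q) (nxy : y \notin <[x]>).

Let sQC : Q \subset C. Proof. exact: pHall_sub sylQ. Qed.

Let sQG : Q \subset G. Proof. exact: subset_trans sQC sCG. Qed.

Let nty : y != 1. Proof. by apply: contraNneq nxy => ->; apply: group1. Qed.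

Let oy : #[y] = 3. Proof. exact (Sylow3_order sylQ Qy nty). Qed.

Let coVQ : coprime #|V| #|Q|.
Proof. by rewrite oV (card_Hall sylQ) C9. Qed.

(** Otherwise [y], outside [<[x]>], would commute with an involution. It is the kernel of the affine
    action of [V ><| <[y]>]. *)
Lemma klein_cent_cycle : 'C_<[y]>(V) = 1.
Proof.
apply: prime_TIg; rewrite -?orderE ?oy // cycle_subG /=; apply/negP=> /centP cyV.
have [z Vz ntz] := klein_pick.
have := Sylow3_no_involution sylQ Qy nxy (subsetP sVG z Vz) (cyV z Vz).
by rewrite klein_order.
Qed.

Let nVG : G \subset 'N(V). Proof. exact: normal_norm klein_normal. Qed.

Let syQ : <[y]> \subset Q. Proof. by rewrite cycle_subG. Qed.

Lemma klein_semidirect : exists A : {group gT}, V ><| <[y]> = A.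
Proof.
exists (V <*> <[y]>)%G; rewrite sdprodEY //.
  by rewrite (subset_trans _ nVG) // (subset_trans syQ).
by rewrite coprime_TIg // (coprime_dvdr (cardSg syQ)).
Qed.

(** The affine image of [A = V ><| <[y]>] is even on both factors and has order 12, so it is the
    whole alternating group. [A] misses [x], since otherwise it would contain [Q], and 9 does not
    divide 12. *)
Lemma isog_Z3A4 : C :=: G -> G \isog G36_11.
Proof.
move=> eCG; have [z Vz ntz] := klein_pick.
have [A defA] := klein_semidirect.
have oA : #|A| = 12 by rewrite -(sdprod_card defA) oV -orderE oy.
have [f [kf fV _]] := klein_affine defA oV klein_square Vz ntz.
have injf : 'injm f by rewrite kf klein_cent_cycle.
have isoA : A \isog 'Alt_('I_4).
  suffices <- : f @* A = 'Alt_('I_4) by apply: sub_isog.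
  apply/eqP; rewrite eqEcard card_Alt4 card_injm // oA leqnn andbT.
  have [/normal_sub sVA syA _ _ _] := sdprod_context defA.
  have -> : f @* A = f @* V * f @* <[y]> by rewrite -morphimMl // (sdprodW defA).
  rewrite mul_subG // morphim_cycle -?cycle_subG //.
  rewrite cycle_subG; apply: odd_order_even_perm.
  by rewrite order_injm -?cycle_subG // oy.
have dxy := Sylow3_dprod sylQ C9 Qy nxy.
have [/normal_sub sVA syA _ _ _] := sdprod_context defA.
have Ay : y \in A by rewrite -cycle_subG.
have tiA : <[x]> :&: A = 1.
  apply: prime_TIg; rewrite -?orderE ?ox //; apply/negP=> Ax.
  have sQA : Q \subset A by rewrite -(dprodW dxy) mul_subG // cycle_subG.
  by have := cardSg sQA; rewrite (card_Hall sylQ) C9 oA.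
have sAC : A \subset C by rewrite -(sdprodW defA) mul_subG // (subset_trans syQ).
have defG : <[x]> \x A = G.
  rewrite dprodE //; last by rewrite cent_cycle (subset_trans sAC) ?subsetIr.
  apply/eqP; rewrite -eCG eqEcard mul_subG //= TI_cardMg // -orderE ox oA.
  by rewrite oC.
by apply: (isog_setX_dprod defG) isoA; apply: isog_cyclic_Zp; rewrite ?cycle_cyclic.
Qed.

(* By the Frattini argument N_G(Q) contains an involution u outside C; it fixes no
   element of order 3, so it inverts Q and normalises <[y]>, and the complement
   to <[x]> is V ><| (<[y]> ><| <[u]>). *)
Lemma isog_Z3S4 u0 : u0 \in G -> u0 \notin C -> G \isog G72_43.
Proof.
move=> Gu0 nCu0; have [iC oG] := card_index2 Gu0 nCu0; rewrite oC in oG.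
have nCG : C <| G by apply: index2_normal.
have oQ : #|Q| = 9 by rewrite (card_Hall sylQ).
have cQ := Sylow3_abelian sylQ C9.
pose N := 'N_G(Q)%G; have CN : C * N = G := Frattini_arg nCG sylQ.
have sNG : N \subset G := subsetIl _ _.
have nQN : Q <| N by rewrite normalSG.
have tiVN : V :&: N = 1.
  apply/trivgP/subsetP=> v /setIP[Vv Nv]; rewrite inE; apply/idPn=> ntv.
  have Gv := subsetP sVG v Vv.
  (* [V] is normal and [v] normalises [Q], so the commutator lies in both; coprimality kills it and
     [y] would commute with the involution [v]. *)
  have : [~ v, y] \in V :&: Q.
    apply/setIP; split.
      rewrite commgEl groupM ?groupV // memJ_norm //.
      by rewrite (subsetP (normal_norm klein_normal)) // (subsetP sQG).
    rewrite commgEr groupM // memJ_norm ?groupV //.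
    by rewrite (subsetP (normal_norm nQN)).
  rewrite coprime_TIg // => /set1P/eqP/commgP cvy.
  have := Sylow3_no_involution sylQ Qy nxy Gv (commute_sym cvy).
  by rewrite klein_order.
have sVQC : V * Q = C.
  by apply/eqP; rewrite eqEcard mul_subG //= (TI_cardMg (coprime_TIg coVQ)) oQ oC oV.
have CIN : C :&: N = Q.
  by rewrite -sVQC setIC -group_modr ?(normal_sub nQN) // setIC tiVN mul1g.
(* The product formula for [C] and [N] reads [36 * #|N| = 72 * 9]. *)
have oN : #|N| = 18.
  have := mul_cardG C N; rewrite CN CIN oG oC oQ => /eqP.
  by rewrite (_ : 2 * 36 * 9 = 36 * 18)%N // eqn_mul2l => /eqP.
have [|u Nu ou] := @Cauchy _ 2 N isT; rewrite ?oN //.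
have Gu := subsetP sNG u Nu.
have nCu : u \notin C.
  apply/negP=> Cu; have : u \in Q by rewrite -CIN inE Cu.
  by move/order_dvdG; rewrite ou oQ.
have comQ := centsP cQ.
have nQu q : q \in Q -> q ^ u \in Q.
  by move=> Qq; rewrite memJ_norm // (subsetP (normal_norm nQN)).
have u2 : u * u = 1 by rewrite -(expg_order u) ou.
have fixQ q : q \in Q -> q ^ u = q -> q = 1.
  move=> Qq /conjg_fixP/commgP cqu; apply/eqP/idPn=> ntq.
  have oq := Sylow3_order sylQ Qq ntq.
  by have [_] := order3_comm_involution (subsetP sQG q Qq) Gu oq ou cqu; apply/negP.
(* As [Q] is abelian and [u * u = 1], the product [q * q ^ u] is fixed by [u], hence trivial. *)
have invQ q : q \in Q -> q ^ u = q^-1.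
  move=> Qq; apply/eqP; rewrite eq_sym eq_invg_mul; apply/eqP.
  apply: fixQ; first exact: groupM (nQu q Qq).
  by rewrite conjMg -conjgM u2 conjg1; apply: comQ; rewrite ?nQu.
have nyu : <[u]> \subset 'N(<[y]>).
  rewrite cycle_subG; apply/normP/eqP.
  by rewrite eqEcard cardJg leqnn andbT -cycleJ invQ // cycle_subG groupV cycle_id.
have tiyu : <[y]> :&: <[u]> = 1 by rewrite coprime_TIg // -!orderE oy ou.
pose M := (<[y]> <*> <[u]>)%G.
have defM : <[y]> ><| <[u]> = M by rewrite sdprodEY.
have oM : #|M| = 6 by rewrite -(sdprod_card defM) -!orderE oy ou.
have sMN : M \subset N by rewrite join_subG !cycle_subG Nu (subsetP (normal_sub nQN)).
have sMG := subset_trans sMN sNG; have nVM := subset_trans sMG nVG.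
have cMy : 'C_M(<[y]>) = <[y]>.
  have tiuC : <[u]> :&: 'C(<[y]>) = 1.
    apply: prime_TIg; rewrite -?orderE ?ou // cycle_subG /= cent_cycle; apply/cent1P=> cuy.
    have yu : y ^ u = y by apply/conjg_fixP/commgP.
    by case/eqP: nty; apply: fixQ.
  have -> : M = <[y]> * <[u]> :> {set gT} by rewrite (sdprodW defM).
  by rewrite -group_modl ?tiuC ?mulg1 //; apply: cycle_abelian.
(* ['C_M(V)] and [<[y]>] are normal in [M] and meet trivially, so they commute; but [<[y]>] is its
   own centraliser in [M]. *)
have cMV : 'C_M(V) = 1.
  have nCM : M \subset 'N('C_M(V)).
    by have := normal_norm (subcent_normal M V); rewrite (setIidPl nVM).
  have nyM : M \subset 'N(<[y]>) by rewrite join_subG normG.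
  have syM : <[y]> \subset M by rewrite joing_subl.
  have tiCy : 'C_M(V) :&: <[y]> = 1.
    by rewrite setIAC (setIidPr syM) klein_cent_cycle.
  have cCy : 'C_M(V) \subset 'C(<[y]>).
    apply/commG1P/trivgP; rewrite -tiCy subsetI commg_subl commg_subr.
    by rewrite (subset_trans syM nCM) (subset_trans (subsetIl _ _) nyM).
  rewrite -tiCy; apply/esym/setIidPl; rewrite -cMy subsetI cCy subsetIl //.
have tiVM : V :&: M = 1 by apply/trivgP; rewrite -tiVN setIS.
pose S := (V <*> M)%G; have defS : V ><| M = S by rewrite sdprodEY.
have oS : #|S| = 24 by rewrite -(sdprod_card defS) oV oM.
have sSG : S \subset G by rewrite join_subG sVG.
have Sy : y \in S by rewrite -cycle_subG (subset_trans _ (joing_subr _ _)) ?joing_subl.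
have Su : u \in S by rewrite -cycle_subG (subset_trans _ (joing_subr _ _)) ?joing_subr.
have sVS : V \subset S by rewrite joing_subl.
have [z Vz ntz] := klein_pick.
have [f [kf fV _]] := klein_affine defS oV klein_square Vz ntz.
have injf : 'injm f by rewrite kf cMV.
have dxy := Sylow3_dprod sylQ C9 Qy nxy.
have tiS : <[x]> :&: S = 1.
  apply: prime_TIg; rewrite -?orderE ?ox //; apply/negP=> Sx.
  have sQS : Q \subset S by rewrite -(dprodW dxy) mul_subG // cycle_subG.
  by have := cardSg sQS; rewrite oQ oS.
have nxG := normal_norm cycle_normal.
have defG : <[x]> ><| S = G.
  rewrite sdprodE ?(subset_trans sSG) //; apply/eqP.
  by rewrite eqEcard mul_subG ?cycle_subG //= TI_cardMg // -orderE ox oS oG.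
have iS := index_cent2 sSG Su nCu.
have [A defA] := klein_semidirect.
have CSA : 'C_S(<[x]>) = A.
  apply/eqP; rewrite eq_sym eqEcard; apply/andP; split.
    rewrite -(sdprodW defA) cent_cycle subsetI mul_subG ?cycle_subG //=.
    by rewrite mul_subG ?(subset_trans sVC) ?(subset_trans syQ) ?(subset_trans sQC) ?subsetIr.
  rewrite -(leq_pmul2r (isT : 0 < 2)) -{1}iS Lagrange ?subsetIl // oS.
  by rewrite -(sdprod_card defA) oV -orderE oy.
have fS : f @* S = [set: {perm 'I_4}].
  by apply/eqP; rewrite eqEcard subsetT card_injm // oS (card_Sym 'I_4) card_ord.
have -> : G72_43 = signmatch (f @* S) by rewrite fS.
apply: (signmatch_isog defG) => //.
  rewrite CSA; have -> : f @* A = f @* V * f @* <[y]>.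
    by rewrite -morphimMl // (sdprodW defA).
  rewrite mul_subG // morphim_cycle // cycle_subG.
  by apply: odd_order_even_perm; rewrite order_injm // oy.
by apply/negP=> /cardSg; rewrite card_injm // oS card_Alt4.
Qed.

End Nine.

(** * Centraliser of order 12 and index 2 *)

Section Three.

Hypothesis C3 : (#|C|`_3 = 3)%N.
Variable W : {group gT}.
Hypotheses (sylW : 2.-Sylow(G) W) (sVW : V \subset W) (nCW : ~~ (W \subset C)).

Let oC : #|C| = 12. Proof. by rewrite (card_pi23 sCG) C4 C3. Qed.

Let sWG : W \subset G. Proof. exact: pHall_sub sylW. Qed.

Let oG : #|G| = 24.
Proof.
have [u Wu nCu] := subsetPn nCW; have [_ ->] := card_index2 (subsetP sWG u Wu) nCu.
by rewrite oC.
Qed.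

Let oW : #|W| = 8. Proof. by rewrite (card_Hall sylW) oG p_part. Qed.

Let nxG : G \subset 'N(<[x]>). Proof. exact: normal_norm cycle_normal. Qed.

(** The order of the intersection divides [gcd(8, 12) = 4], which is the order of [V]. *)
Lemma Sylow2_cent : W :&: C = V.
Proof.
apply/eqP; rewrite eq_sym eqEcard subsetI sVW sVC oV /=; apply: dvdn_leq => //.
rewrite (_ : 4 = gcdn #|W| #|C|) ?oW ?oC // dvdn_gcd -{1}oW -{1}oC.
by rewrite !cardSg ?subsetIl ?subsetIr.
Qed.

Lemma Sylow2_subcent : 'C_W(<[x]>) = V.
Proof. by rewrite cent_cycle -Sylow2_cent setIA (setIidPl sWG). Qed.

Lemma Sylow2_sdprod (A : {group gT}) :
  A \subset W -> exists2 L : {group gT}, <[x]> ><| A = L & #|L| = (3 * #|A|)%N.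
Proof.
move=> sAW; have cop : coprime #|<[x]>| #|A|.
  by rewrite (coprime_dvdr (cardSg sAW)) // oW -orderE ox.
have defL : <[x]> ><| A = <[x]> <*> A.
  by rewrite sdprodEY ?coprime_TIg // (subset_trans _ nxG) // (subset_trans sAW).
by exists (<[x]> <*> A)%G => //; rewrite -(sdprod_card defL) -orderE ox.
Qed.

Lemma Sylow2_square u : u \in W -> u \notin C -> u * u \in V.
Proof.
move=> Wu nCu; have iV := index_cent2 sWG Wu nCu; rewrite Sylow2_subcent in iV.
have nVu : u \notin V by apply: contra nCu; apply: (subsetP sVC).
apply/idPn=> nV; have : u * u \in V :* u.
  by rewrite (rcoset_index2 sVW iV) in_setD ?nV ?groupM // nVu.
by rewrite mem_rcoset mulgK (negbTE nVu).
Qed.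

(** [L = <[x]> ><| <[u]>] is nonabelian of order 6. Both [x] and [u] centralise [V], and [L] meets
    [C] only in [<[x]>], so [G] is the direct product of [V] and [L]. *)
Lemma isog_Z2Z2S3 u :
  u \in W -> u \notin C -> #[u] = 2 -> u \in 'C(V) -> G \isog G24_14.
Proof.
move=> Wu nCu ou cuV; have sUW : <[u]> \subset W by rewrite cycle_subG.
have [L defL oL] := Sylow2_sdprod sUW; rewrite -orderE ou in oL.
have tiUC : <[u]> :&: C = 1 by rewrite prime_TIg // -?orderE ?ou // cycle_subG.
have LC : L :&: C = <[x]>.
  by rewrite -(sdprodW defL) -group_modl // tiUC mulg1.
have tiVL : V :&: L = 1.
  rewrite -(setIidPl sVC) -setIA [C :&: L]setIC LC coprime_TIg //.
  by rewrite oV -orderE ox.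
have cVx : V \subset 'C[x] by rewrite (subset_trans sVC) ?subsetIr.
have cLV : L \subset 'C(V).
  rewrite -(sdprodW defL) mul_subG // ?cycle_subG //.
  by rewrite -sub1set centsC cent_set1.
have sLG : L \subset G by rewrite -(sdprodW defL) mul_subG ?cycle_subG // (subsetP sWG).
have defG : V \x L = G.
  rewrite dprodE //; apply/eqP; rewrite eqEcard mul_subG //= TI_cardMg //.
  by rewrite oV oL oG.
have isoL : L \isog [set: {perm 'I_3}].
  apply: (nonabelian_order6_isog defL); rewrite -?orderE //.
  apply: prime_TIg; rewrite -?orderE ?ou // cycle_subG /= cent_cycle.
  by apply: contra nCu => cu; rewrite inE (subsetP sWG).
have isoV : V \isog [set: 'Z_2 * 'Z_2].
  have [s Vs nts] := klein_pick.
  have [t Vt nst] : exists2 t, t \in V & t \notin <[s]>.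
    by apply/subsetPn; apply/negP=> /subset_leq_card; rewrite oV -orderE klein_order.
  have ntt : t != 1 by apply: contraNneq nst => ->; apply: group1.
  have os := klein_order Vs nts; have ot := klein_order Vt ntt.
  have tits : <[t]> :&: <[s]> = 1.
    by apply: prime_TIg; rewrite -?orderE ?ot // cycle_subG.
  have defV : <[t]> \x <[s]> = V.
    rewrite dprodE //; last by apply: (sub_abelian_cent2 klein_abelian); rewrite cycle_subG.
    by apply/eqP; rewrite eqEcard mul_subG ?cycle_subG //= TI_cardMg // -!orderE os ot oV.
  have -> : [set: 'Z_2 * 'Z_2] = setX [set: 'Z_2] [set: 'Z_2] by apply/setP=> p; rewrite !inE.
  by apply: (isog_setX_dprod defV); apply: isog_cyclic_Zp; rewrite ?cycle_cyclic.
have -> : G24_14 = setX [set: 'Z_2 * 'Z_2] [set: {perm 'I_3}].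
  by apply/setP=> p; rewrite !inE.
exact: (isog_setX_dprod (A' := [set: 'Z_2 * 'Z_2]%G) defG).
Qed.

(** An involution [w] of [V] other than [u * u] is central and avoids [L = <[x]> ><| <[u]>], because
    [<[u]>] has only one involution. It splits off, and [L] is matched against [<[cyc4]>]. *)
Lemma isog_Z2Dic3 u : u \in W -> u \notin C -> #[u] = 4 -> u \in 'C(V) -> G \isog G24_7.
Proof.
move=> Wu nCu ou cuV; have sUW : <[u]> \subset W by rewrite cycle_subG.
have [L defL oL] := Sylow2_sdprod sUW; rewrite -orderE ou in oL.
have ou2 : #[u * u] = 2 by rewrite -[u * u]/(u ^+ 2) orderXdiv ou.
have [w Vw nuw] : exists2 w, w \in V & w \notin <[u * u]>.
  by apply/subsetPn; apply/negP=> /subset_leq_card; rewrite oV -orderE ou2.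
have ntw : w != 1 by apply: contraNneq nuw => ->; apply: group1.
have ow := klein_order Vw ntw; have Cw := subsetP sVC w Vw.
have sLG : L \subset G by rewrite -(sdprodW defL) mul_subG ?cycle_subG // (subsetP sWG).
have [_ sUL _ _ _] := sdprod_context defL.
have WL : W :&: L = <[u]>.
  apply/eqP; rewrite eq_sym eqEcard subsetI sUW sUL -orderE ou /=; apply: dvdn_leq => //.
  rewrite (_ : 4 = gcdn #|W| #|L|) ?oW ?oL // dvdn_gcd -{1}oW -{1}oL.
  by rewrite !cardSg ?subsetIl ?subsetIr.
have tiwL : <[w]> :&: L = 1.
  apply: prime_TIg; rewrite -?orderE ?ow // cycle_subG; apply: contra nuw => Lw.
  have uw : w \in <[u]> by rewrite -WL inE (subsetP sVW).
  have uu : u * u \in <[u]> by rewrite groupM ?cycle_id.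
  by rewrite (involution_cyclic_uniq (cycle_cyclic u) uw uu ow ou2) cycle_id.
have cLw : L \subset 'C(<[w]>).
  rewrite -(sdprodW defL) mul_subG //= cent_cycle cycle_subG.
    by rewrite cent1C; have /setIP[] := Cw.
  by apply/cent1P; apply: (centP cuV).
have defG : <[w]> \x L = G.
  rewrite dprodE //; apply/eqP; rewrite eqEcard mul_subG ?cycle_subG ?(subsetP sVG) //=.
  by rewrite TI_cardMg // -orderE ow oL oG.
have isoU : <[u]> \isog <[cyc4]>.
  by rewrite isog_cyclic_card ?cycle_cyclic // -!orderE order_cyc4 ou.
have [g injg img] := isogP isoU.
have isoL : L \isog signmatch <[cyc4]>.
  rewrite -img; apply: (signmatch_isog defL) => //.
  - by apply: (index_cent2 (u := u)); rewrite ?cycle_id // (subset_trans sUW).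
  (* An element of [<[u]>] centralising [x] lies in [V] and squares to 1, so its image is an even
     power of [cyc4]. *)
  - apply/subsetP=> _ /morphimP[c _ /setIP[uc xc] ->].
    have Vc : c \in V by rewrite -Sylow2_subcent inE xc (subsetP sUW).
    have : g c \in <[cyc4]> by rewrite -img mem_morphim.
    case/cycleP=> k gk; rewrite Alt_even gk.
    have : cyc4 ^+ (k * 2) = 1.
      by rewrite expgM -gk -morphX // expgS expg1 klein_square // morph1.
    move/eqP; rewrite -order_dvdn order_cyc4 -[4]/(2 * 2)%N dvdn_pmul2r //.
    case/dvdnP=> j ->; rewrite mulnC expgM.
    elim: j => [|j IH]; first by rewrite odd_perm1.
    by rewrite expgS odd_permM [odd_perm (cyc4 ^+ 2)]odd_permM addbb.
  rewrite img cycle_subG Alt_even negbK; exact: odd_cyc4.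
apply: (isog_setX_dprod (A' := [set: 'Z_2]%G) (B' := signmatch_group <[cyc4]>) defG) => //.
by apply: isog_cyclic_Zp; rewrite ?cycle_cyclic.
Qed.

(** Since [v] is its own inverse, [v ^ u * v] is the commutator of [u] and [v], nontrivial as soon
    as [u] moves [v]. Because [u * u] lies in the abelian group [V], conjugation by [u] merely swaps
    [v] and [v ^ u]. *)
Lemma klein_commutator u :
  u \in W -> u \notin C -> u \notin 'C(V) ->
  exists2 v, v \in V & [/\ v ^ u * v \in V, v ^ u * v != 1 & (v ^ u * v) ^ u = v ^ u * v].
Proof.
move=> Wu nCu ncu; have [v Vv nuv] : exists2 v, v \in V & v ^ u != v.
  apply/exists_inP; rewrite -negb_forall_in; apply: contra ncu => /forall_inP cVu.
  by apply/centP=> v Vv; apply/commute_sym/commgP/conjg_fixP/eqP/cVu.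
have Gu := subsetP sWG u Wu.
have Vvu : v ^ u \in V by rewrite memJ_norm // (subsetP (normal_norm klein_normal)).
exists v => //; split; first exact: groupM.
  apply: contra nuv => /eqP e; apply/eqP/(mulIg v).
  by rewrite e klein_square.
have cV := centsP klein_abelian.
rewrite conjMg -conjgM (_ : v ^ (u * u) = v); first exact: cV.
by apply/conjg_fixP/commgP/cV; rewrite ?Sylow2_square.
Qed.

(** An involution outside [C] generates a complement to [V] in [W], which is what [klein_affine]
    needs. *)
Lemma noncentral_involution u :
  u \in W -> u \notin C -> u \notin 'C(V) ->
  exists s, [/\ s \in W, s \notin C, #[s] = 2 & s \notin 'C(V)].
Proof.
move=> Wu nCu ncu; have Gu := subsetP sWG u Wu.
have := mem_p_elt (pHall_pgroup sylW) Wu; have := ordG Gu.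
rewrite /p_elt !inE => /or4P[|||/orP[]] /eqP ou; rewrite ou // => _.
- by case/negP: nCu; move/eqP: ou; rewrite order_eq1 => /eqP->.
- by exists u.
(* Both u * u and v ^ u * v generate 'C_V[u], so (u * v) ^+ 2 = 1. *)
have [v Vv [Vz ntz uz]] := klein_commutator Wu nCu ncu.
have u2 : u * u != 1 by rewrite -[u * u]/(u ^+ 2) -order_dvdn ou.
have ez : u * u = v ^ u * v.
  apply/eqP/idPn=> nz; pose D := 'C_V[u]%G.
  have memD w : w \in V -> w ^ u = w -> w \in D.
    by move=> Vw wu; rewrite inE Vw; apply/cent1P/commgP/conjg_fixP.
  have s3D : [set u * u; v ^ u * v] :|: [set 1] \subset D.
    rewrite !subUset !sub1set group1 andbT !memD ?Sylow2_square //.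
    by apply/conjg_fixP/commgP; rewrite /commute mulgA.
  have := subset_leq_card s3D; rewrite setUC cardsU1 cards2 nz !inE negb_or.
  rewrite ![1 == _]eq_sym u2 ntz /= => leD.
  have DV : D = V :> {set gT}.
    apply/eqP; rewrite eqEcard subsetIl oV.
    have := cardSg (subsetIl V 'C[u]); rewrite oV -/D.
    by case: #|D| leD => [|[|[|[|]]]].
  have : v \in D by rewrite DV.
  case/setIP=> _ /cent1P/commgP/conjg_fixP e.
  by move: ntz; rewrite e klein_square ?eqxx.
have u_v2 : (u * v) ^+ 2 = 1.
  rewrite expgS expg1 (_ : u * v * (u * v) = u * u * (v ^ u * v)).
    by rewrite ez klein_square.
  by rewrite !mulgA -(mulgA u v u) (conjgC v u) !mulgA.
have nCuv : u * v \notin C by rewrite groupMr // (subsetP sVC).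
exists (u * v); split=> //.
- by rewrite groupM // (subsetP sVW).
- by apply: nt_prime_order => //; apply: contraNneq nCuv => ->; apply: group1.
by rewrite groupMr // (subsetP klein_abelian).
Qed.

(** The commutator [z] is central in [W] and is labelled so as to act as [dtrans], which puts the
    image of [W] inside ['C[dtrans]]. That centraliser has order divisible by 8, dividing 24 and
    different from 24, since [cyc4] does not commute with [dtrans]. *)
Lemma isog_Z3D8 u : u \in W -> u \notin C -> u \notin 'C(V) -> G \isog G24_8.
Proof.
move=> Wu0 nCu0 ncu0; have [{Wu0 nCu0 ncu0}u [Wu nCu ou ncu]] := noncentral_involution Wu0 nCu0 ncu0.
have [v Vv [Vz ntz uz]] := klein_commutator Wu nCu ncu; set z := v ^ u * v in Vz ntz uz.
have Gu := subsetP sWG u Wu.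
have tiVu : V :&: <[u]> = 1.
  rewrite setIC prime_TIg -?orderE ?ou // cycle_subG.
  by apply: contra nCu; apply: (subsetP sVC).
have defW : V ><| <[u]> = W.
  rewrite sdprodE ?cycle_subG ?(subsetP (normal_norm klein_normal)) //.
  by apply/eqP; rewrite eqEcard mul_subG ?cycle_subG //= TI_cardMg // -orderE ou oV oW.
have [f [kf fV fz]] := klein_affine defW oV klein_square Vz ntz.
have injf : 'injm f.
  by rewrite kf prime_TIg // -?orderE ?ou // cycle_subG.
have Wz := subsetP sVW z Vz.
have zW : W \subset 'C[z].
  rewrite -(sdprodW defW) mul_subG //=.
    by rewrite -cent_set1 centsC sub1set (subsetP klein_abelian).
  rewrite cycle_subG; apply/cent1P/commute_sym/commgP/conjg_fixP; exact: uz.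
have fW : f @* W = 'C[dtrans].
  have sfW : f @* W \subset 'C[dtrans].
    apply/subsetP=> _ /morphimP[w _ Ww ->]; rewrite -fz; apply/cent1P.
    by rewrite /commute -!morphM //; congr (f _); apply/cent1P/(subsetP zW).
  apply/eqP; rewrite eqEcard sfW card_injm // oW /=.
  have d8 := cardSg sfW; rewrite card_injm // oW in d8.
  have d24 : #|'C[dtrans]| %| 24.
    by have := cardSg (subsetT 'C[dtrans]); rewrite (card_Sym 'I_4) card_ord.
  have n24 : #|'C[dtrans]| != 24.
    apply/eqP=> o24; have : 'C[dtrans] = [set: {perm 'I_4}].
      by apply/eqP; rewrite eqEcard subsetT o24 (card_Sym 'I_4) card_ord.
    move/setP/(_ cyc4); rewrite [RHS]inE => /cent1P/permP/(_ ord0)/(congr1 val).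
    by rewrite (permM cyc4) (permM dtrans) /= !perm4_val.
  have : #|'C[dtrans]| \in divisors 24 by rewrite -dvdn_divisors.
  rewrite !inE; move: d8 n24; move: #|'C[dtrans]| => n d8 n24.
  by do ?case/orP; move=> /eqP e; rewrite e in d8 n24 *.
have -> : G24_8 = signmatch (f @* W) by rewrite fW.
have [L defL oL] := Sylow2_sdprod (subxx W).
have defG : <[x]> ><| W = G.
  rewrite defL; apply/eqP; rewrite eqEcard oL oG oW leqnn andbT.
  by rewrite -(sdprodW defL) mul_subG ?cycle_subG.
apply: (signmatch_isog defG) => //.
- exact: index_cent2 sWG Wu nCu.
- by rewrite Sylow2_subcent.
by apply/negP=> /cardSg; rewrite card_injm // oW card_Alt4.
Qed.

End Three.

End Klein.

Lemma isog_listed :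
  G \isog G12_5 \/ G \isog G18_3 \/ G \isog G24_7 \/ G \isog G24_8 \/
    G \isog G24_14 \/ G \isog G36_11 \/ G \isog G72_43.
Proof.
case: card_cent_part2 => [C2 | C4]; first by right; left; apply: isog_Z3S3.
have [V sylV] := Sylow_exists 2 C; have sVG := subset_trans (pHall_sub sylV) sCG.
case: card_cent_part3 => [C3 | C9]; last first.
  have [Q sylQ] := Sylow_exists 3 C; have [y Qy nxy] := Sylow3_supplement sylQ C9.
  case: cent_full_or_index2 => [eCG | [u Gu nCu]]; do 5![right].
    by left; apply: (isog_Z3A4 sylV C4 C9 sylQ Qy nxy).
  by right; apply: (isog_Z3S4 sylV C4 C9 sylQ Qy nxy Gu nCu).
case: cent_full_or_index2 => [eCG | [u0 Gu0 nCu0]].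
  by left; apply: (isog_Z2Z6 sylV).
have [W sylW sVW] := Sylow_superset sVG (pHall_pgroup sylV).
have [iC oG] := card_index2 Gu0 nCu0.
have nCW : ~~ (W \subset C).
  apply/negP=> /cardSg; rewrite (card_Hall sylW) oG (card_pi23 sCG) C4 C3.
  by rewrite !p_part.
have [u Wu nCu] := subsetPn nCW; do 2![right].
have [cu | ncu] := boolP (u \in 'C(V)); last first.
  by right; left; apply: (isog_Z3D8 sylV C4 C3 sylW sVW nCW Wu nCu ncu).
have Gu := subsetP (pHall_sub sylW) u Wu.
(* Here [u] centralises [V] and is a 2-element outside [C], so its order is 2 or 4: the complement
   [W] is elementary abelian or [Z_4 x Z_2]. *)
have := mem_p_elt (pHall_pgroup sylW) Wu; have := ordG Gu.
rewrite /p_elt !inE => /or4P[|||/orP[]] /eqP ou; rewrite ou // => _.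
- by case/negP: nCu; move/eqP: ou; rewrite order_eq1 => /eqP->.
- by do 2![right]; left; apply: (isog_Z2Z2S3 sylV C4 C3 sylW nCW Wu nCu ou cu).
by left; apply: (isog_Z2Dic3 sylV C4 C3 sylW sVW nCW Wu nCu ou cu).
Qed.

End Structure.

Theorem theorem3p3 (gT : finGroupType) (G : {group gT}) :
  {in G, forall x, #[x] \in [:: 1; 2; 3; 4; 6]%N} ->
  #|cyc6_subgroups G| = 3 ->
  ((exists H K : {group gT},
       [/\ H \in cyc6_subgroups G, K \in cyc6_subgroups G & #|H :&: K| = 3])
   <->
   (G \isog G12_5 \/ G \isog G18_3 \/ G \isog G24_7 \/ G \isog G24_8 \/
    G \isog G24_14 \/ G \isog G36_11 \/ G \isog G72_43)).
Proof.
move=> ordG oJ; split; last exact: listed_cyc6_pair.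
move=> /(common_order3_cycle oJ)[x [Gx ox] [sub6 oI]].
exact: (isog_listed ordG Gx ox sub6 oI).
Qed.
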